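(* Suppose $\lambda$, $\mu$ are infinite cardinals, $|I| = \lambda$, and $\mathcal{D}_0$, $\mathcal{G}$, $g_*$ are such that: (a) $\mathcal{D}_0$ is a regular filter on $I$; (b) $g_* \notin \mathcal{G}$ and $(I, \mathcal{D}_0, \mathcal{G} \cup \{g_*\})$ is $(\lambda, \mu)$-good; (c) $\mu^+ < \lambda$; (d) $\mathrm{Range}(g_* ) = \mu$. Then there is a filter $\mathcal{D} \supseteq \mathcal{D}_0$ on $I$ such that: (a) $(I, \mathcal{D}, \mathcal{G})$ is $(\lambda, \mu)$-good; (b) if $\mathcal{D}_*$ is any ultrafilter on $I$ extending $\mathcal{D}$ and $M \models T_{\mathrm{rg}}$, then $M^I/\mathcal{D}_*$ is not $\mu^{++}$-saturated; in particular, it is not $\lambda^+$-saturated.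
   Context: $T_{\mathrm{rg}}$ is the first-order theory of the random (Rado) graph, in the language with one binary relation symbol $R$. Regular filter: a filter $\mathcal{D}$ on $I$, $|I|=\lambda$, is regular if there is a family $\langle X_i : i < \lambda\rangle$ of members of $\mathcal{D}$ such that each $t \in I$ lies in only finitely many $X_i$. ''$A = \emptyset \bmod \mathcal{D}$'' means $I \setminus A \in \mathcal{D}$. Good triples: let $\lambda \geq \mu \geq \aleph_0$, $|I| = \lambda$, $\mathcal{D}$ a regular filter on $I$ and $\mathcal{G}$ a family of functions from $I$ to $\mu$. $\mathrm{FI}(\mathcal{G})$ is the set of functions $h$ whose domain is a finite subset of $\mathcal{G}$ and such that $h(g) \in \mathrm{Range}(g)$ for $g \in \mathrm{dom}(h)$. For $h \in \mathrm{FI}(\mathcal{G})$, $A_h = \{ t \in I : g(t) = h(g) \text{ for all } g \in \mathrm{dom}(h)\}$. The triple $(I, \mathcal{D}, \mathcal{G})$ is $(\lambda,\mu)$-pre-good if $A_h \neq \emptyset \bmod \mathcal{D}$ for every $h \in \mathrm{FI}(\mathcal{G})$, and $(\lambda,\mu)$-good if moreover $\mathcal{D}$ is maximal among the filters $\mathcal{D}'$ on $I$ for which $(I, \mathcal{D}', \mathcal{G})$ is $(\lambda,\mu)$-pre-good. *)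

(* Defs.v *)
From mathcomp Require Import all_boot.
From mathcomp Require Import boolp classical_sets functions cardinality filter.

Set Implicit Arguments.
Unset Strict Implicit.
Unset Printing Implicit Defensive.

Local Open Scope classical_set_scope.
Local Open Scope card_scope.

(* A cardinal is represented by a type of that cardinality; an index ranging
   over the ordinals below the cardinal then ranges over the type. *)

Definition card_lt (T U : Type) (A : set T) (B : set U) : Prop :=
  A #<= B /\ A #!= B.

Definition is_succ_card (K K' : Type) : Prop :=
  card_lt [set: K] [set: K'] /\
  forall T : Type, card_lt [set: K] [set: T] -> [set: K'] #<= [set: T].

Definition regular_filter (L I : Type) (D : set_system I) : Prop :=
  [/\ [set: I] #= [set: L], ProperFilter D &
      exists X : L -> set I,
        (forall i, D (X i)) /\ (forall t, finite_set [set i | X i t])].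

Definition empty_mod (I : Type) (D : set_system I) (A : set I) : Prop :=
  D (~` A).

Definition pdom (S T : Type) (h : S -> option T) : set S :=
  [set s | exists a, h s = Some a].

Definition FI (I Mu : Type) (G : set (I -> Mu)) :
    set ((I -> Mu) -> option Mu) :=
  [set h | [/\ finite_set (pdom h), pdom h `<=` G &
               forall g a, h g = Some a -> range g a]].

Definition A_ (I Mu : Type) (h : (I -> Mu) -> option Mu) : set I :=
  [set t | forall g a, h g = Some a -> g t = a].

Definition pre_good (L Mu I : Type) (D : set_system I) (G : set (I -> Mu)) :
    Prop :=
  [/\ infinite_set [set: Mu], [set: Mu] #<= [set: L], regular_filter L D &
      forall h, FI G h -> ~ empty_mod D (A_ h)].

Definition good (L Mu I : Type) (D : set_system I) (G : set (I -> Mu)) : Prop :=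
  pre_good L D G /\
  forall D' : set_system I, pre_good L D' G -> D `<=` D' -> D' = D.

Record structure : Type := Structure {
  carrier :> Type;
  edge : carrier -> carrier -> Prop }.

(* First-order formulas in the language {R} whose free variables are elements
   of V; under a quantifier the fresh bound variable is None. *)
Inductive formula (V : Type) : Type :=
  | fEq of V & V
  | fR of V & V
  | fFalse
  | fImp of formula V & formula V
  | fAll of formula (option V).

Definition scons (V M : Type) (x : M) (v : V -> M) (o : option V) : M :=
  if o is Some y then v y else x.

Fixpoint sat (M : structure) (V : Type) (v : V -> M) (phi : formula V) : Prop :=
  match phi with
  | fEq x y => v x = v y
  | fR x y => edge (v x) (v y)
  | fFalse => False
  | fImp p q => sat v p -> sat v q
  | fAll p => forall x : M, sat (scons x v) p
  end.

Definition sentence : Type := formula void.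

Definition holds (M : structure) (phi : sentence) : Prop := sat (of_void M) phi.

Definition models (M : structure) (T : set sentence) : Prop :=
  forall phi, T phi -> holds M phi.

(* Ackermann's coding of the Rado graph: the smaller of i, j is a position at
   which the binary expansion of the larger has digit 1. *)
Definition rado : structure :=
  @Structure nat (fun i j => odd (i %/ 2 ^ j) || odd (j %/ 2 ^ i)).

Definition T_rg : set sentence := [set phi | holds rado phi].

Definition eq_mod (I : Type) (D : set_system I) (M : Type) (f g : I -> M) :
    Prop :=
  D [set t | f t = g t].

(* The points of M^I / D are the equivalence classes of eq_mod D. *)
Definition ultrapower (M : structure) (I : Type) (D : set_system I) :
    structure :=
  @Structure {C : set (I -> M) | exists f, C = [set g | eq_mod D f g]}
    (fun a b => exists f g, [/\ sval a f, sval b g &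
                               D [set t | edge (f t) (g t)]]).

(* Formulas in one variable with parameters in A: the variable is None and
   Some a is the parameter a. *)
Definition formula1 (N : structure) (A : set N) : Type := formula (option A).

Definition satisfies (N : structure) (A : set N) (x : N) (phi : formula1 A) :
    Prop :=
  sat (scons x (fun a : A => val a)) phi.

Definition realizes (N : structure) (A : set N) (x : N)
    (p : set (formula1 A)) : Prop :=
  forall phi, p phi -> satisfies x phi.

Definition is_type (N : structure) (A : set N) (p : set (formula1 A)) : Prop :=
  forall q, finite_set q -> q `<=` p -> exists x, realizes x q.

Definition saturated (K : Type) (N : structure) : Prop :=
  forall A : set N, card_lt A [set: K] ->
  forall p : set (formula1 A), is_type p -> exists x, realizes x p.

(* Main.v *)
(* Split [gs] into functions [h (j, i)], for [j] in an order [J] of type mu^+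
   and [i : bool], with values in a countable set, which are independent modulo
   a filter [D1] containing [D0], over [G]. For [X : nat -> set I] such that
   every [X n] is decided, modulo [D1], by conditions on [G] and on the
   [h (a, i)] with [a < j], add to [D1] the set of those [t] at which
   [h (j, true)] and [h (j, false)] take distinct values [m], [n] with
   [X m t <-> X n t]. By pigeonhole, [j] by [j] in increasing order, this
   leaves [G] independent, so the filter extends to a good one, [D]. Let [m_n]
   be distinct points of [M]. The points of the ultrapower given by
   [m_(h (j, i))] are distinct, so the type
   [R x m_(h (j, true)), ~ R x m_(h (j, false))], for [j] in [J], is finitely
   satisfiable. For [b] in [I -> M] the sets [X n] of those [t] with
   [R (b t) m_n] are decided by mu functions, hence by [G] and the
   [h (a, i)] with [a < j] for some [j]; so [b] does not realize the type. *)
Require Import Defs.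
From Stdlib Require List.
From mathcomp Require Import all_boot.
From mathcomp Require Import boolp classical_sets functions cardinality filter.
From mathcomp Require Import wochoice.

Set Implicit Arguments.
Unset Strict Implicit.
Unset Printing Implicit Defensive.

Local Open Scope classical_set_scope.
Local Open Scope card_scope.

(** * Cardinal arithmetic *)

Definition embeds (T U : Type) : Prop := exists f : T -> U, injective f.

Lemma embedsP (T U : Type) : [set: T] #<= [set: U] <-> embeds T U.
Proof.
rewrite -(rwP card_leP) injfunPex; split=> [[f _ fI]|[f fI]].
  exists (fun x => set_val (f (SigSub (in_setT x)))) => x y /val_inj /fI.
  by rewrite !in_setT => /(_ isT isT) /(congr1 val).
exists (fun x => SigSub (in_setT (f (set_val x)))) => // x y _ _.
by move=> /(congr1 val) /fI /val_inj.
Qed.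

Lemma embeds_trans (T U V : Type) : embeds T U -> embeds U V -> embeds T V.
Proof. by move=> [f fI] [g gI]; exists (g \o f); apply: inj_comp. Qed.

Lemma embeds_pair (T T' U U' : Type) :
  embeds T U -> embeds T' U' -> embeds (T * T') (U * U').
Proof.
move=> [f fI] [g gI]; exists (fun p => (f p.1, g p.2)).
by move=> [x y] [x' y'] [/fI -> /gI ->].
Qed.

Lemma embeds_surj (T U : Type) (u0 : T) :
  embeds T U -> exists g : U -> T, forall x, exists y, g y = x.
Proof.
move=> [f fI].
have /choice [g gP] : forall y, exists x, (exists x', f x' = y) -> f x = y.
  move=> y; have [[x <-]|ny] := pselect (exists x', f x' = y); first by exists x.
  by exists u0 => /ny.
by exists g => x; exists (f x); apply/fI/gP; exists x.
Qed.

(* A maximal graph of a partial injection is total or onto. *)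
Lemma embeds_total (T U : Type) : embeds T U \/ embeds U T.
Proof.
pose P (r : set (T * U)) := (forall x y y', r (x, y) -> r (x, y') -> y = y') /\
  (forall x x' y, r (x, y) -> r (x', y) -> x = x').
have [|r [[rf ri] rmax]] := @Zorn_bigcup _ P.
  move=> F FP Ftot; split.
    move=> x y y' [r Fr rxy] [r' Fr' rxy'].
    have [rr'|rr'] := Ftot _ _ Fr Fr'.
      by apply: (FP _ Fr').1 rxy'; apply: rr'.
    by apply: (FP _ Fr).1 rxy _; apply: rr'.
  move=> x y y' [r Fr rxy] [r' Fr' rxy'].
  have [rr'|rr'] := Ftot _ _ Fr Fr'.
    by apply: (FP _ Fr').2 rxy'; apply: rr'.
  by apply: (FP _ Fr).2 rxy _; apply: rr'.
have [tot|/existsNP [x0 nx0]] := pselect (forall x, exists y, r (x, y)).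
  have [f fP] := choice tot; left; exists f => x x' e.
  by apply: (ri _ _ (f x)) => //; rewrite e.
have [onto|/existsNP [y0 ny0]] := pselect (forall y, exists x, r (x, y)).
  have [f fP] := choice onto; right; exists f => y y' e.
  by apply: (rf (f y)) => //; rewrite e.
case: (rmax (r `|` [set (x0, y0)])).
  split; first by move=> p rp; left.
  by move=> /(_ (x0, y0) (or_intror erefl)) r0; apply: nx0; exists y0.
split.
  move=> x y y' [rxy|[-> ->]] [rxy'|[]].
  - exact: rf rxy rxy'.
  - by move=> e _; case: nx0; exists y; rewrite -e.
  - by case: nx0; exists y'.
  - by move=> ->.
move=> x x' y [rxy|[-> ->]] [rxy'|[]].
- exact: ri rxy rxy'.
- by move=> _ e; case: ny0; exists x; rewrite -e.
- by case: ny0; exists x'.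
- by move=> ->.
Qed.

Lemma sum_embeds_prod (T : Type) (a b : T) : a <> b -> embeds (T + T) (T * T).
Proof.
move=> ab; exists (fun s => match s with inl x => (a, x) | inr x => (b, x) end).
by move=> [x|x] [y|y] /= [] => [->|/ab|/esym/ab|->].
Qed.

(* Zorn, applied to the graphs of injections [A * A -> A]: a maximal one has
   [A] as large as [T], since otherwise [A] can be doubled. *)
Lemma embeds_square (T : Type) : infinite_set [set: T] -> embeds (T * T) T.
Proof.
move=> /infiniteP/embedsP [e eI].
(* The subset whose square [r] maps is read off the diagonal. [Q r] says that [r] is the graph of an
   injection from [dom r * dom r] to [dom r]. *)
pose dom (r : set ((T * T) * T)) x := exists z, r ((x, x), z).
pose Q (r : set ((T * T) * T)) :=
  [/\ forall p z z', r (p, z) -> r (p, z') -> z = z',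
      forall p p' z, r (p, z) -> r (p', z) -> p = p',
      forall x y, dom r x -> dom r y -> exists z, r ((x, y), z) &
      forall x y z, r ((x, y), z) -> [/\ dom r x, dom r y & dom r z]].
pose r0 : set ((T * T) * T) := [set q | exists i j : nat,
  q = ((e i, e j), e (pickle (i, j)))].
have d0 x : dom r0 x <-> exists i, x = e i.
  split; first by move=> [z [i [j [-> _ _]]]]; exists i.
  by move=> [i ->]; exists (e (pickle (i, i))), i, i.
have Qr0 : Q r0.
  split.
  - by move=> p z z' [i [j [-> ->]]] [i' [j' [/eI -> /eI -> ->]]].
  - move=> p p' z [i [j [-> ->]]] [i' [j' [-> /eI]]].
    by move=> /(pcan_inj pickleK) [-> ->].
  - move=> x y /d0 [i ->] /d0 [j ->]; exists (e (pickle (i, j))).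
    by exists i, j.
  - move=> x y z [i [j [-> -> ->]]].
    by split; apply/d0; eexists.
(* Taking the union with [r0] covers the empty chain and keeps a copy of [nat] inside the domain. *)
have [|r [Qr rmax]] := @Zorn_bigcup _ [set r | Q (r0 `|` r)].
  move=> F FQ Ftot.
  have sub r : F r -> r0 `|` r `<=` r0 `|` \bigcup_(X in F) X.
    by move=> Fr q [?|?]; [left|right; exists r].
  have one q : (r0 `|` \bigcup_(X in F) X) q ->
      r0 q \/ exists2 r, F r & (r0 `|` r) q.
    by move=> [?|[r Fr rq]]; [left|right; exists r => //; right].
  have up q q' : (r0 `|` \bigcup_(X in F) X) q ->
      (r0 `|` \bigcup_(X in F) X) q' ->
      exists r, [/\ Q r, r q, r q' & r `<=` r0 `|` \bigcup_(X in F) X].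
    have r0sub : r0 `<=` r0 `|` \bigcup_(X in F) X by left.
    move=> /one [q0|[r Fr rq]] /one [q'0|[r' Fr' rq']].
    - by exists r0.
    - by exists (r0 `|` r'); split; [exact: FQ|left| |exact: sub].
    - by exists (r0 `|` r); split; [exact: FQ| |left|exact: sub].
    have [rr'|rr'] := Ftot _ _ Fr Fr'.
      exists (r0 `|` r'); split=> //; [exact: FQ| |exact: sub].
      by case: rq => [?|/rr' ?]; [left|right].
    exists (r0 `|` r); split=> //; [exact: FQ| |exact: sub].
    by case: rq' => [?|/rr' ?]; [left|right].
  split.
  - by move=> p z z' h h'; have [s [[+ _ _ _] + + _]] := up _ _ h h'; apply.
  - by move=> p p' z h h'; have [s [[_ + _ _] + + _]] := up _ _ h h'; apply.
  - move=> x y [z h] [z' h'].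
    have [s [[_ _ + _] sx sy ssub]] := up _ _ h h'.
    by case/(_ x y); [exists z|exists z'|move=> w /ssub; exists w].
  - move=> x y z h; have [s [[_ _ _ +] + _ ssub]] := up _ _ h h.
    move=> /[apply] -[[a /ssub ?] [b /ssub ?] [c /ssub ?]].
    by split; [exists a|exists b|exists c].
set R := r0 `|` r in Qr; have [Rf Ri Rd Rr] := Qr.
pose A := {x | dom R x}.
have Ae i : dom R (e i).
  by exists (e (pickle (i, i))); left; exists i, i.
pose eA i : A := exist _ (e i) (Ae i).
have eAI : injective eA by move=> i j [/eI].
have Aeq (a b : A) : sval a = sval b -> a = b.
  by case: a b => [a pa] [b pb] /= ab; subst b; congr exist.
have /choice [f fP] : forall p : A * A, exists z : A,
    R ((sval p.1, sval p.2), sval z).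
  move=> [[x dx] [y dy]] /=; have [z Rz] := Rd _ _ dx dy.
  by have [_ _ dz] := Rr _ _ _ Rz; exists (exist _ z dz).
have fI : injective f.
  move=> [a b] [a' b'] e1; have := fP (a, b); rewrite e1 => h.
  by have [/Aeq -> /Aeq ->] := Ri _ _ _ h (fP (a', b')).
have splitT : embeds T (A + {x | ~ dom R x}).
  exists (fun x => match pselect (dom R x) with
           | left d => inl (exist _ x d) | right d => inr (exist _ x d) end).
  by move=> x y; do 2 case: pselect => ?; move=> // [].
have sAT : embeds A T by exists sval => a b /Aeq.
(* If the complement embeds in [A], then [T] embeds in [A + A], hence in [A * A], hence in [A].
   Otherwise the complement contains a copy [B] of [A], and the graph extends to the square of the
   union of [A] and [B]. *)
have [[b bI]|[b bI]] := embeds_total A {x | ~ dom R x}; last first.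
  have TA : embeds T A.
    apply: embeds_trans splitT _.
    apply: (@embeds_trans _ (A + A)).
      exists (fun s => match s with inl x => inl x | inr y => inr (b y) end).
      by move=> [x|x] [y|y] //= [] => [->|/bI ->].
    apply: (@embeds_trans _ (A * A)); last by exists f.
    by apply: (@sum_embeds_prod _ (eA 0) (eA 1)); move=> /eAI.
  apply: embeds_trans sAT; apply: (@embeds_trans _ (A * A)); last by exists f.
  exact: embeds_pair.
exfalso.
pose B x := exists a, x = sval (b a).
have nB x : B x -> ~ dom R x by move=> [a ->]; case: (b a).
have bI' a a' : sval (b a) = sval (b a') -> a = a'.
  move=> h; apply: bI; case: (b a) (b a') h => [x px] [y py] /= h; subst y.
  by congr exist.
have /choice [u uP] : forall x, exists a : A,
    (dom R x \/ B x) -> (dom R x -> x = sval a) /\ (~ dom R x -> x = sval (b a)).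
  move=> x; have [dx|ndx] := pselect (dom R x).
    by exists (exist _ x dx).
  have [[a xa]|nBx] := pselect (B x); first by exists a.
  by exists (eA 0) => -[].
(* Both halves are indexed by [A] through [u], so a pair is coded in [A] by its two indices and two
   bits telling the halves. The new pairs are sent into [B], away from the old values. *)
pose tag x y : bool * bool := (`[< dom R x >], `[< dom R y >]).
pose c x y := f (eA (pickle (tag x y)), f (u x, u y)).
pose N : set ((T * T) * T) := [set q | exists x y,
  [/\ dom R x \/ B x, dom R y \/ B y, ~ (dom R x /\ dom R y) &
      q = ((x, y), sval (b (c x y)))]].
have sN : N `<=` r0 `|` (r `|` N) by move=> q; right; right.
have sR : R `<=` r0 `|` (r `|` N).
  by move=> q [?|?]; [left|right; left].
have RN q : (r0 `|` (r `|` N)) q -> R q \/ N q.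
  by move=> [?|[?|?]]; [left; left|left; right|right].
have uI x y : dom R x \/ B x -> dom R y \/ B y ->
    `[< dom R x >] = `[< dom R y >] -> u x = u y -> x = y.
  move=> /uP [ux nux] /uP [uy nuy].
  have [dx|ndx] := asboolP (dom R x); have [dy|ndy] := asboolP (dom R y) => //.
    by move=> _ e1; rewrite (ux dx) e1 -(uy dy).
  by move=> _ e1; rewrite (nux ndx) e1 -(nuy ndy).
have dN x : dom (r0 `|` (r `|` N)) x <-> dom R x \/ B x.
  split.
    move=> [z /RN [h|[x' [y' [dx _ _ [-> _ _]]]]]] //.
    by left; exists z.
  move=> [[z /sR h]|Bx]; first by exists z.
  exists (sval (b (c x x))); apply: sN; exists x, x; split=> //.
  - by right.
  - by right.
  - by move=> [/(nB _ Bx)].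
apply: (rmax (r `|` N)).
  split; first by left.
  (* The extension is proper: a pair from [B] is in [N] and has its value outside [dom R]. *)
  move=> h; have NR : N `<=` R by move=> q Nq; right; apply: h; right.
  have [_ _] : [/\ dom R (sval (b (eA 0))), dom R (sval (b (eA 0))) &
      dom R (sval (b (c (sval (b (eA 0))) (sval (b (eA 0))))))].
    apply: Rr; apply: NR; exists (sval (b (eA 0))), (sval (b (eA 0))).
    split=> //.
    - by right; exists (eA 0).
    - by right; exists (eA 0).
    - by move=> [d _]; case: (b (eA 0)) d.
  by case: (b _).
split.
- move=> p z z' /RN [h|[x [y [dx dy ndxy [pe ->]]]]]
    /RN [h'|[x' [y' [dx' dy' ndxy' [pe' ->]]]]].
  + exact: Rf h h'.
  + by move: h; rewrite pe' => /Rr [? ? _]; case: ndxy'.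
  + by move: h'; rewrite pe => /Rr [? ? _]; case: ndxy.
  + by move: pe'; rewrite pe => -[-> ->].
- move=> p p' z /RN [h|[x [y [dx dy ndxy [pe ze]]]]]
    /RN [h'|[x' [y' [dx' dy' ndxy' [pe' ze']]]]].
  + exact: Ri h h'.
  + case: p h => ? ? /Rr [_ _]; rewrite ze' => d.
    by case: (b _) d.
  + case: p' h' => ? ? /Rr [_ _]; rewrite ze => d.
    by case: (b _) d.
  + move: ze'; rewrite ze => /bI' /fI [/eI/(pcan_inj pickleK) [tx ty]].
    by move=> /fI [/(uI _ _ dx dx' tx) ex /(uI _ _ dy dy' ty) ey]; rewrite pe pe' ex ey.
- move=> x y /dN dx /dN dy.
  have [[dRx dRy]|nd] := pselect (dom R x /\ dom R y).
    by have [z /sR Rz] := Rd _ _ dRx dRy; exists z.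
  by exists (sval (b (c x y))); apply: sN; exists x, y.
- move=> x y z /RN [/Rr [dx dy dz]|[x' [y' [dx dy nd [-> -> ->]]]]].
    by split; apply/dN; left.
  split; try exact/dN.
  by apply/dN; right; exists (c x' y').
Qed.

(** Iterated pairing alone is ambiguous, since the end marker [e 0] may itself code a pair; storing
    the length resolves this. *)
Lemma embeds_seq (T : Type) : infinite_set [set: T] -> embeds (seq T) T.
Proof.
move=> Tinf; have [e eI] := (embedsP _ _).1 ((infiniteP _).1 Tinf).
have [q qI] := embeds_square Tinf.
pose code := foldr (fun x y => q (x, y)) (e 0).
exists (fun s => q (e (size s), code s)) => s s' /qI [/eI].
elim: s s' => [|x s IH] [|x' s'] //= [/IH {}IH] /qI [-> /IH].
by move=> ->.
Qed.

Lemma embeds_nat (T : Type) : infinite_set [set: T] -> embeds nat T.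
Proof. by move=> /infiniteP/embedsP. Qed.

Lemma Cantor_embeds (T : Type) : ~ embeds (set T) T.
Proof.
move=> [f fI]; pose A := [set x | exists2 B, f B = x & ~ B x].
have nA : ~ A (f A) by move=> fA; case: (fA) => B /fI ->.
exact: (nA (ex_intro2 _ _ A erefl nA)).
Qed.

(** By Cantor the power set is strictly larger than [K], so the least larger cardinal is at most
    that. This allows points of [K'] to be named by subsets of [K]. *)
Lemma succ_embeds_set (K K' : Type) : is_succ_card K K' -> embeds K' (set K).
Proof.
move=> [_ /(_ (set K)) succ]; apply/embedsP/succ; split.
  apply/embedsP; exists (fun x => [set x]) => x y xy.
  by have : [set y] x by rewrite -xy.
apply/negP; rewrite card_eq_le => /andP [_ le].
by apply: (@Cantor_embeds K); apply/embedsP.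
Qed.

Lemma succ_not_embeds (K K' : Type) : is_succ_card K K' -> ~ embeds K' K.
Proof.
move=> [[le /negP ne] _] /embedsP ge; apply: ne.
by rewrite card_eq_le le ge.
Qed.

(** The strict form of the well-ordering principle. Totality, antisymmetry and transitivity all come
    from the unique minimum of a set of two or three points. *)
Lemma wo_exists (T : Type) : exists lt : T -> T -> Prop,
  [/\ forall P : T -> Prop, (exists x, P x) ->
        exists x, P x /\ forall y, P y -> y = x \/ lt x y,
      forall x, ~ lt x x,
      forall x y z, lt x y -> lt y z -> lt x z &
      forall x y, [\/ lt x y, x = y | lt y x]].
Proof.
have [R Rwo] := well_ordering_principle {classic T}.
have minR (P : T -> Prop) : (exists x, P x) ->
    exists x, P x /\ forall y, P y -> R x y.
  move=> [x Px]; have [|z [[Pz zmin] _]] := Rwo (fun x => `[< P x >]).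
    by exists x; apply/asboolP.
  exists z; split; first exact/asboolP.
  by move=> y Py; apply: zmin; apply/asboolP.
have Rtot x y : R x y \/ R y x.
  have [|z [[->|->] zmin]] := minR (fun z => z = x \/ z = y); first by exists x; left.
    by left; apply: zmin; right.
  by right; apply: zmin; left.
have Rxx x : R x x by case: (Rtot x x).
have Ranti x y : R x y -> R y x -> x = y.
  move=> xy yx; have [|z [_ zU]] := Rwo (fun z => `[< z = x \/ z = y >]).
    by exists x; apply/asboolP; left.
  have zw w : w = x \/ w = y -> z = w.
    move=> we; apply: zU; split; first exact/asboolP.
    by move=> v /asboolP [->|->]; case: we => ->.
  by rewrite -(zw x (or_introl erefl)) -(zw y (or_intror erefl)).
have Rtr x y z : R x y -> R y z -> R x z.
  move=> xy yz; have [|w [wP wmin]] := minR (fun w => [\/ w = x, w = y | w = z]).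
    by exists x; constructor 1.
  have wx : R w x by apply: wmin; constructor 1.
  have wy : R w y by apply: wmin; constructor 2.
  have wz : R w z by apply: wmin; constructor 3.
  case: wP => we; subst w => //.
    by rewrite (Ranti _ _ xy wx).
  by rewrite -(Ranti _ _ yz wy).
exists (fun x y => R x y /\ x <> y); split.
- move=> P /minR [x [Px xmin]]; exists x; split=> // y /xmin Rxy.
  by have [->|/nesym ne] := pselect (y = x); [left|right].
- by move=> x [].
- move=> x y z [xy nxy] [yz nyz]; split; first exact: Rtr yz.
  by move=> xz; subst z; apply: nxy; apply: Ranti.
- move=> x y; have [->|ne] := pselect (x = y); first by constructor 2.
  by case: (Rtot x y) => h; [constructor 1|constructor 3; split=> //; exact: nesym].
Qed.

(* The order type of [J] is the initial ordinal of the successor of [T]. *)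
Lemma cofinal_order (T K : Type) : infinite_set [set: T] -> ~ embeds K T ->
  exists (J : Type) (lt : J -> J -> Prop),
  [/\ embeds J K, well_founded lt,
      forall x y z, lt x y -> lt y z -> lt x z,
      forall x y, x <> y -> lt x y \/ lt y x &
      inhabited J /\ forall S : T -> J, exists b, forall t, lt (S t) b].
Proof.
move=> Tinf nKT; have [lt [ltmin ltxx lttr lttot]] := wo_exists K.
have [e eI] := embeds_nat Tinf.
(* A point is small if its predecessors inject into [T]; [J] is the initial segment below all points
   that are not small. *)
pose small x := exists f : K -> T,
  forall y z, lt y x -> lt z x -> f y = f z -> y = z.
pose inJ y := forall x, ~ small x -> lt y x.
pose J := {y | inJ y}.
have nJT : ~ embeds J T.
  move=> [f fI].
  have gI : exists g : K -> T, forall y z, inJ y -> inJ z -> g y = g z -> y = z.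
    exists (fun y => if pselect (inJ y) is left h then f (exist _ y h) else e 0).
    by move=> y z yJ zJ; case: pselect => // h; case: pselect => // h' /fI [].
  (* The predecessors of the least non-small point all lie in [J], so an injection of [J] would make
     it small. If all points are small, [J] is all of [K]. *)
  have [/ltmin [x [bigx xmin]]|nbig] := pselect (exists x, ~ small x).
    apply: bigx; have [g gP] := gI; exists g => y z yx zx; apply: gP.
      by move=> w /xmin [->//|]; exact: lttr yx.
    by move=> w /xmin [->//|]; exact: lttr zx.
  apply: nKT; have [g gP] := gI; exists g => y z.
  by apply: gP => w bigw; case: nbig; exists w.
have Jsmall y : inJ y -> small y.
  by move=> yJ; apply: contrapT => /yJ /ltxx.
have Jeq (a b : J) : sval a = sval b -> a = b.
  by case: a b => [a pa] [b pb] /= ab; subst b; congr exist.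
exists J, (fun a b => lt (sval a) (sval b)); split.
- by exists sval => a b /Jeq.
- move=> a; apply: contrapT => na.
  have [|x [[xJ nx] xmin]] := ltmin (fun y => exists yJ : inJ y,
      ~ Acc (fun a b : J => lt (sval a) (sval b)) (exist _ y yJ)).
    by case: a na => a aJ na; exists a, aJ.
  apply: nx; constructor => -[y yJ] /= yx; apply: contrapT => ny.
  case: (xmin y); first by exists yJ.
    by move=> e1; apply: (ltxx x); rewrite -[X in lt X _]e1.
  by move=> /lttr /(_ yx) /ltxx.
- by move=> x y z; apply: lttr.
- move=> x y ne; case: (lttot (sval x) (sval y)) => [|/Jeq //|]; by [left|right].
split.
  by apply: contrapT => nJ; apply: nJT; exists (fun=> e 0) => x; case: nJ; exists.
(* If [S] is unbounded, each [b] is at most some [S (m b)]. It is coded by [m b], by a bit for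
   equality, and by its place among the predecessors of [S (m b)], which inject into [T]. *)
move=> S; apply: contrapT => nb; apply: nJT.
have /choice [m mP] : forall b : J, exists t, ~ lt (sval (S t)) (sval b).
  by move=> b; apply/existsNP => h; apply: nb; exists b.
have /choice [f fP] : forall b : J, exists f : K -> T, forall y z,
    lt y (sval b) -> lt z (sval b) -> f y = f z -> y = z.
  by move=> [b bJ]; apply: Jsmall.
have [q qI] := embeds_square Tinf.
exists (fun b => q (m b, q (e `[< b = S (m b) >], f (S (m b)) (sval b)))) => a b.
move=> /qI [mab /qI [/eI]]; rewrite mab.
have [ea|na] := asboolP (a = S (m b)); have [eb|nb'] := asboolP (b = S (m b)) => //.
  by move=> _ _; rewrite ea.
have ltS c : m c = m b -> c <> S (m b) -> lt (sval c) (sval (S (m b))).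
  move=> mc nc; case: (lttot (sval c) (sval (S (m b)))) => [//|/Jeq //|].
  by rewrite -mc => /mP.
by move=> _ /(fP _ _ _ (ltS _ mab na) (ltS _ erefl nb')) /Jeq.
Qed.

Lemma In_nth (X : Type) (x0 x : X) (s : seq X) :
  List.In x s -> exists2 i, i < size s & nth x0 s i = x.
Proof.
elim: s => //= y s IH [->|/IH [i ? ?]]; first by exists 0.
by exists i.+1.
Qed.

Lemma nth_In (X : Type) (x0 : X) (s : seq X) i :
  i < size s -> List.In (nth x0 s i) s.
Proof. by elim: s i => //= y s IH [|i] h; [left|right; apply: IH]. Qed.

(** The closure of a point under as many finitary operations as [T] has elements is reached in
    countably many stages, each indexed by [T], so [T] indexes the whole closure. *)
Lemma small_closure (T X : Type) (x0 : X) (F : T -> seq X -> seq X) :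
  infinite_set [set: T] ->
  exists phi : T -> X, range phi x0 /\
    forall t s, List.Forall (range phi) s -> List.Forall (range phi) (F t s).
Proof.
move=> Tinf; have [e eI] := embeds_nat Tinf.
have [t0 _] := infinite_setN0 Tinf.
have sq := embeds_square Tinf.
have [|d dS] := @embeds_surj ((T * seq T) * nat) T ((t0, [::]), 0).
  apply: embeds_trans (sq); apply: embeds_pair; last by exists e.
  apply: embeds_trans (sq); apply: embeds_pair; first by exists id.
  exact: embeds_seq.
have [|d' d'S] := @embeds_surj (nat * T) T (0, t0).
  by apply: embeds_trans (sq); apply: embeds_pair; [exists e|exists id].
(* The index [t] codes an operation, a list of arguments and a position. Putting the arguments
   before the results makes each stage contain the previous one. *)
pose next (phi : T -> X) t :=
  let s := map phi (d t).1.2 in nth x0 (s ++ F (d t).1.1 s) (d t).2.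
pose stage n := iter n next (fun=> x0).
have stageS n t : range (stage n.+1) (stage n t).
  by have [u du] := dS ((t0, [:: t]), 0); exists u => //; rewrite /= /next du.
have stage_le m n t : m <= n -> range (stage n) (stage m t).
  elim: n => [|n IH]; first by rewrite leqn0 => /eqP ->; exists t.
  rewrite leq_eqVlt => /orP [/eqP ->|/IH [u _ <-]]; last exact: stageS.
  by exists t.
exists (fun t => stage (d' t).1 (d' t).2).
have stage_range n t : range (fun t => stage (d' t).1 (d' t).2) (stage n t).
  by have [u du] := d'S (n, t); exists u => //; rewrite du.
split; first exact: (stage_range 0 t0).
(* The stages increase, so a finite list from their union lies in a single stage. *)
move=> t s sP; have [n [s' ->]] : exists n s', s = map (stage n) s'.
  elim: s sP => [|x s IH]; first by exists 0, [::].
  move=> h; inversion_clear h as [|? ? [u _ <-] sP].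
  have [n [s' ->]] := IH sP; pose N := maxn n (d' u).1.
  have [v _ <-] := stage_le _ N (d' u).2 (leq_maxr _ _).
  suff [s'' ->] : exists s'', map (stage n) s' = map (stage N) s''.
    by exists N, (v :: s'').
  elim: s' {IH sP} => [|w s' [s'' IH]]; first by exists [::].
  have [w' _ e'] := stage_le n N w (leq_maxl _ _).
  by exists (w' :: s''); rewrite /= IH e'.
apply/List.Forall_forall => x /(In_nth x0) [i ilt <-].
have [u du] := dS ((t, s'), size s' + i).
suff <- : stage n.+1 u = nth x0 (F t (map (stage n) s')) i by [].
by rewrite /= /next du /= nth_cat size_map ltnNge leq_addr /= addKn.
Qed.

(** * Conditions and good filters *)

Lemma finite_set_list (X : Type) (A : set X) :
  finite_set A <-> exists s, forall x, A x <-> List.In x s.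
Proof.
split=> [|[s sP]].
  move=> /(@finite_seqP {classic X}) [s ->]; exists s => x /=.
  elim: s => //= y s IH; rewrite inE; split=> [/orP [/eqP ->|/IH]|]; [by left|by right|].
  by move=> [->|/IH ->]; rewrite ?eqxx ?orbT.
suff : finite_set [set x | List.In x s] by apply: sub_finite_set => x /sP.
elim: s {sP} => [|y s IH]; first exact: finite_set0.
rewrite (_ : [set x | _] = [set y] `|` [set x | List.In x s]).
  by rewrite finite_setU; split=> //; exact: finite_set1.
by apply/seteqP; split=> x /= [->|?]; by [left|right].
Qed.

Definition cell (I T : Type) (c : seq ((I -> T) * T)) : set I :=
  [set t | forall g a, List.In (g, a) c -> g t = a].

Definition functional (S T : Type) (c : seq (S * T)) : Prop :=
  forall g a b, List.In (g, a) c -> List.In (g, b) c -> a = b.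

(* Elements of [FI W], as lists of pairs. *)
Definition cond (I T : Type) (W : set (I -> T)) (c : seq ((I -> T) * T)) :
    Prop :=
  (forall g a, List.In (g, a) c -> W g /\ range g a) /\ functional c.

Definition independent (I T : Type) (D : set_system I) (W : set (I -> T)) :
    Prop :=
  forall c, cond W c -> ~ D (~` cell c).

(** Finite partial functions and functional lists describe the same conditions; lists can be
    concatenated and treated by induction. *)
Lemma independentP (I T : Type) (D : set_system I) (W : set (I -> T)) :
  (forall h, FI W h -> ~ empty_mod D (A_ h)) <-> independent D W.
Proof.
split=> [DW c [cW cf]|DW h [/finite_set_list [s sP] hW hr]].
  pose h g := if pselect (exists a, List.In (g, a) c) is left e
              then Some (projT1 (cid e)) else None.
  have hP g a : h g = Some a <-> List.In (g, a) c.
    rewrite /h; case: pselect => [e|ne]; last by split=> // ga; case: ne; exists a.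
    case: cid => b /= gb; split; first by case=> <-.
    by move=> ga; rewrite (cf _ _ _ ga gb).
  have -> : cell c = A_ h by apply/seteqP; split=> t ct g a /hP; apply: ct.
  apply: DW; split.
  - apply/finite_set_list; exists (map fst c) => g.
    rewrite List.in_map_iff; split=> [[a /hP ga]|[[g' a] /= [<- ga]]].
      by exists (g, a).
    by exists a; apply/hP.
  - by move=> g [a /hP /cW []].
  - by move=> g a /hP /cW [].
pose c := pmap (fun g => omap (pair g) (h g)) s.
have cP g a : List.In (g, a) c <-> h g = Some a.
  have -> : List.In (g, a) c <-> List.In g s /\ h g = Some a.
    rewrite /c; elim: s {sP c} => [|g' s IH] /=; first by split=> // -[].
    case hg: (h g') => [b|] /=; rewrite IH; split.
    - by move=> [[<- <-]|[? ?]]; split=> //; [left|right].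
    - by move=> [[<-|?] e]; [left; move: e; rewrite hg => -[->]|right].
    - by move=> [? ?]; split=> //; right.
    - by move=> [[<-|?] e]; [move: e; rewrite hg|].
  by split=> [[]//|e]; split=> //; apply/sP; exists a.
have -> : A_ h = cell c by apply/seteqP; split=> t ct g a /cP; apply: ct.
apply: DW; split=> [g a /cP e|g a b /cP e /cP]; last by rewrite e => -[].
by split; [apply: hW; exists a|exact: hr].
Qed.

Lemma pre_goodS (L T I : Type) (D D' : set_system I) (W W' : set (I -> T)) :
  pre_good L D W -> D `<=` D' -> ProperFilter D' -> independent D' W' ->
  pre_good L D' W'.
Proof.
move=> [Tinf TL [IL _ [X [XD Xfin]]] _] DD' D'P D'W; split=> //.
  by split=> //; exists X; split=> // i; apply: DD'.
exact/independentP.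
Qed.

Lemma pre_good_good (L T I : Type) (D : set_system I) (W : set (I -> T)) :
  pre_good L D W -> exists2 D', good L D' W & D `<=` D'.
Proof.
(* Zorn runs over what is added to [D], so that the empty chain yields [D] itself. *)
move=> DW; have [|E [EP Emax]] :=
    @Zorn_bigcup (set I) [set E : set (set I) | pre_good L (D `|` E) W].
  move=> F FP Ftot; pose U := D `|` \bigcup_(X in F) X; change (pre_good L U W).
  have sD : D `<=` U by left.
  have sE E : F E -> D `|` E `<=` U.
    by move=> FE A [?|?]; [left|right; exists E].
  have up A B : U A -> U B ->
      exists E, [/\ pre_good L E W, E A, E B & E `<=` U].
    move=> [DA|[E FE EA]] [DB|[E' FE' E'B]].
    - by exists D.
    - by exists (D `|` E'); split; [exact: FP|left|right|exact: sE].
    - by exists (D `|` E); split; [exact: FP|right|left|exact: sE].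
    have [EE'|EE'] := Ftot _ _ FE FE'.
      exists (D `|` E'); split; [exact: FP|right; exact: EE'|by right|exact: sE].
    by exists (D `|` E); split; [exact: FP|right|right; exact: EE'|exact: sE].
  apply: (pre_goodS DW sD).
    split.
      move=> h; have [E [[_ _ [_ EF _] _] E0 _ _]] := up _ _ h h.
      exact: (@filter_not_empty _ E).
    split.
    - by case: DW => _ _ [_ DF _] _; apply: sD; apply: filterT.
    - move=> A B UA UB; have [E [[_ _ [_ EF _] _] EA EB EU]] := up _ _ UA UB.
      by apply: EU; apply: filterI.
    - move=> A B AB UA; have [E [[_ _ [_ EF _] _] EA _ EU]] := up _ _ UA UA.
      by apply: EU; apply: filterS EA.
  move=> c cW h; have [E [[_ _ _ /independentP EW] Ec _ _]] := up _ _ h h.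
  exact: EW cW Ec.
exists (D `|` E); last by left.
split=> // D' D'W sub; apply/seteqP; split=> // A D'A; apply: contrapT => nA.
apply: (Emax D').
  by split=> [B EB|h]; [apply: sub; right|apply: nA; right; exact: h].
by rewrite /= (_ : D `|` D' = D') //; apply/setUidPr => B DB; apply: sub; left.
Qed.

Lemma good_filter (L T I : Type) (D : set_system I) (W : set (I -> T)) :
  good L D W -> ProperFilter D.
Proof. by move=> [[_ _ []]]. Qed.

Lemma cond_cat (I T : Type) (W : set (I -> T)) c c' :
  cond W c -> cond W c' ->
  (forall g a b, List.In (g, a) c -> List.In (g, b) c' -> a = b) ->
  cond W (c ++ c').
Proof.
move=> [cW cf] [c'W c'f] cc'; split.
  by move=> g a /List.in_app_iff [/cW|/c'W].
move=> g a b /List.in_app_iff [ga|ga] /List.in_app_iff [gb|gb].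
- exact: cf ga gb.
- exact: cc' ga gb.
- exact/esym/(cc' g).
- exact: c'f ga gb.
Qed.

Lemma condS (I T : Type) (W W' : set (I -> T)) c :
  W `<=` W' -> cond W c -> cond W' c.
Proof. by move=> WW' [cW cf]; split=> // g a /cW [/WW' ? ?]. Qed.

Lemma cell_incl (I T : Type) (c c' : seq ((I -> T) * T)) :
  List.incl c c' -> cell c' `<=` cell c.
Proof. by move=> cc' t ct g a /cc' /ct. Qed.

(** In forcing terms, [c] forces membership in [X] or forces its failure, modulo [D]. *)
Definition decides (I T : Type) (D : set_system I) (c : seq ((I -> T) * T))
    (X : set I) : Prop :=
  D [set t | cell c t -> X t] \/ D [set t | cell c t -> ~ X t].

Lemma decidesS (I T : Type) (D : set_system I) (c c' : seq ((I -> T) * T)) X :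
  Filter D -> List.incl c c' -> decides D c X -> decides D c' X.
Proof.
by move=> DF cc' [] h; [left|right]; apply: filterS h => t ct /(cell_incl cc') /ct.
Qed.

(* If no extension of [c] decides [X] negatively then adding [cell c -> X] to
   [D] preserves independence, so this set is in [D] by maximality. *)
Lemma good_decides (L T I : Type) (D : set_system I) (W : set (I -> T)) X c :
  good L D W -> cond W c ->
  exists c', [/\ cond W c', List.incl c c' & decides D c' X].
Proof.
move=> DW cW; have DP := good_filter DW; apply: contrapT => nd.
have nd' c' : cond W c' -> List.incl c c' ->
    ~ D [set t | cell c' t -> ~ X t].
  by move=> c'W cc' h; apply: nd; exists c'; split=> //; right.
pose Y := [set t | cell c t -> X t].
pose D' : set_system I := [set A | D [set t | Y t -> A t]].
have DD' : D `<=` D' by move=> A; apply: filterS => t At _.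
have D'W : independent D' W.
  move=> c1 c1W; rewrite /D' /= => h.
  have [cc1|/existsNP [g /existsNP [a /existsNP [b]]]] :=
      pselect (forall g a b, List.In (g, a) c -> List.In (g, b) c1 -> a = b).
    apply: (nd' _ (cond_cat cW c1W cc1)); first exact/List.incl_appl/List.incl_refl.
    apply: filterS h => t Yt ct Xt; apply: Yt => //.
    by apply: cell_incl ct; exact/List.incl_appr/List.incl_refl.
  (* If [c] and [c1] disagree on some [g], then [cell c1] misses [cell c] and so lies in [Y]; then
     [D] itself would contain the complement of [cell c1]. *)
  move=> /not_implyP [ga /not_implyP [gb ab]].
  case: DW.1 => _ _ _ /independentP /(_ _ c1W); apply.
  apply: filterS h => t Yt ct; apply: Yt => // /(_ _ _ ga) ta.
  by case: ab; rewrite -ta; exact: ct.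
have D'P : ProperFilter D'.
  split; last first.
    split; first by apply: DD'; apply: filterT.
      move=> A B DA DB.
      apply: (@filterS _ D _ _ _ _ (@filterI _ D _ _ _ DA DB)) => t [h1 h2] Yt.
      by split; [exact: h1|exact: h2].
    by rewrite /D' /= => A B AB; apply: (@filterS _ D) => t h /h /AB.
  rewrite /D' /= => h; have c0W : cond W [::] by split.
  by apply: (D'W _ c0W); apply: (@filterS _ D _ _ _ _ h) => t Yt /Yt.
have := DW.2 D' (pre_goodS DW.1 DD' D'P D'W) DD' => e.
apply: nd; exists c; split; [by []|exact: List.incl_refl|left].
have : D' Y by apply: (@filterE _ D) => t Yt.
by rewrite e.
Qed.

Lemma In_filter (X : Type) (P : X -> Prop) (s : seq X) x :
  List.In x [seq y <- s | `[< P y >]] <-> List.In x s /\ P x.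
Proof.
elim: s => /= [|y s IH]; first by split=> // -[].
case: asboolP => Py /=; rewrite IH; split.
- by move=> [<-|[? ?]]; split=> //; [left|right].
- by move=> [[->|?] ?]; [left|right].
- by move=> [? ?]; split=> //; right.
- by move=> [[<-|?] ?].
Qed.

(** Density in the sense of forcing. It serves as the meaning of [X] being determined, modulo [D],
    by the functions in [W]. *)
Definition densely_decides (I T : Type) (D : set_system I) (W : set (I -> T))
    (X : set I) : Prop :=
  forall c, cond W c ->
  exists c', [/\ cond W c', List.incl c c' & decides D c' X].

(** Only the part of [c] over [W] is extended, and the rest is then put back. No clash arises, since
    the extension speaks only of functions in [W], on which it already contains [c]. *)
Lemma densely_decidesS (I T : Type) (D : set_system I) (W W' : set (I -> T)) X :
  Filter D -> W `<=` W' -> densely_decides D W X -> densely_decides D W' X.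
Proof.
move=> DF WW' WX c cW'; pose c0 := [seq q <- c | `[< W q.1 >]].
have c0P g a : List.In (g, a) c0 <-> List.In (g, a) c /\ W g.
  exact: (In_filter (fun q => W q.1) c (g, a)).
have [|c' [c'W cc' c'X]] := WX c0.
  split; first by move=> g a /c0P [/cW'.1 [_ ?] ?].
  by move=> g a b /c0P [ga _] /c0P [gb _]; apply: cW'.2 ga gb.
exists (c ++ c'); split.
- apply: cond_cat => //; first exact: condS c'W.
  move=> g a b ga gb; apply: (c'W.2 _ _ _ _ gb); apply: cc'; apply/c0P; split=> //.
  exact: (c'W.1 _ _ gb).1.
- exact/List.incl_appl/List.incl_refl.
- by apply: (decidesS DF _ c'X); exact/List.incl_appr/List.incl_refl.
Qed.

Lemma densely_decides_seq (I T : Type) (D : set_system I) (W : set (I -> T)) s :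
  Filter D -> (forall X, List.In X s -> densely_decides D W X) ->
  forall c, cond W c ->
  exists c', [/\ cond W c', List.incl c c' &
                 forall X, List.In X s -> decides D c' X].
Proof.
move=> DF; elim: s => [|X s IH] sW c cW.
  by exists c; split=> //; exact: List.incl_refl.
have [|c1 [c1W cc1 c1s]] := IH _ c cW; first by move=> Y sY; apply: sW; right.
have [|c2 [c2W c12 c2X]] := sW X _ c1 c1W; first by left.
exists c2; split=> //; first exact: List.incl_tran c12.
by move=> Y [<- //|/c1s]; apply: decidesS.
Qed.

Lemma zip_fst_snd (S T : Type) (s : seq (S * T)) : zip (map fst s) (map snd s) = s.
Proof. exact: zip_unzip. Qed.

(* Close off under a choice of deciding extensions, so that any condition can be
   extended to a deciding one by looking only at its part below [range phi]. *)
Lemma small_densely_decides (L T I : Type) (D : set_system I)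
    (U : set (I -> T)) (X : nat -> set I) :
  good L D U -> U !=set0 ->
  exists phi : T -> I -> T,
    forall n, densely_decides D (range phi `&` U) (X n).
Proof.
move=> DU [u0 _]; have [[Tinf _ _ _] _] := DU.
have [e eI] := embeds_nat Tinf; have [t0 _] := infinite_setN0 Tinf.
have /choice [ext extP] : forall nc : nat * seq ((I -> T) * T), exists c',
    cond U nc.2 -> [/\ cond U c', List.incl nc.2 c' & decides D c' (X nc.1)].
  move=> [n c] /=; have [cU|ncU] := pselect (cond U c); last by exists c.
  by have [c' ?] := good_decides (X n) DU cU; exists c'.
have [|d dS] := @embeds_surj (nat * seq T) T (0, [::]).
  apply: embeds_trans (embeds_square Tinf).
  by apply: embeds_pair; [exists e|exact: embeds_seq].
(* The arguments of an operation are functions; [d t] supplies the number [n] and the values that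
   turn them into a condition. The result lists the functions of the chosen extension. *)
have [phi [_ phiP]] := small_closure u0
  (fun t s => map fst (ext ((d t).1, zip s (d t).2))) Tinf.
exists phi => n c [cW cf]; have cU : cond U c by split=> // g a /cW [[]].
have [c'U cc' c'X] := extP (n, c) cU.
exists (ext (n, c)); split=> //; split; last by case: c'U.
have [t dt] := dS (n, map snd c).
have /List.Forall_forall ph : List.Forall (range phi) (map fst (ext (n, c))).
  have := phiP t (map fst c); rewrite dt /= zip_fst_snd; apply.
  by apply/List.Forall_forall => g /List.in_map_iff [[g' a] /= [<-]] /cW [[]].
move=> g a ga; have [Ug ra] := c'U.1 _ _ ga; split=> //; split=> //.
by apply: ph; apply/List.in_map_iff; exists (g, a).
Qed.

(** There are [2 ^ size s + 1] indices but at most [2 ^ size s] patterns of truth values along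
    [s]. *)
Lemma seq_pigeonhole (X : Type) (s : seq X) (P : nat -> X -> Prop) :
  exists i j, [/\ i <= 2 ^ size s, j <= 2 ^ size s, i <> j &
    forall x, List.In x s -> (P i x <-> P j x)].
Proof.
case: s => [|x0 s0]; first by exists 0, 1; split=> // x [].
set s := x0 :: s0.
pose f (i : 'I_(2 ^ size s).+1) :=
  [ffun k : 'I_(size s) => `[< P i (nth x0 s k) >]].
have /injectivePn [i [j ij fij]] : ~~ injectiveb f.
  apply/negP => /injectiveP /leq_card.
  by rewrite card_ffun card_bool !card_ord ltnn.
exists i, j; split; [exact: (ltn_ord i)|exact: (ltn_ord j)| |].
  by move=> /val_inj e; rewrite e eqxx in ij.
move=> x /(In_nth x0) [k klt <-].
have /(congr1 (fun g : {ffun _} => g (Ordinal klt))) := fij.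
rewrite !ffunE => h; exact: (asbool_eq_equiv h).
Qed.

Lemma seq_max (J : Type) (lt : J -> J -> Prop) (s : seq J) :
  (forall x y z, lt x y -> lt y z -> lt x z) ->
  (forall x y, x <> y -> lt x y \/ lt y x) ->
  s <> [::] -> exists b, List.In b s /\ forall x, List.In x s -> x = b \/ lt x b.
Proof.
move=> lttr lttot; elim: s => // x s IH _.
have [->|/IH [b [sb bmax]]] := pselect (s = [::]).
  by exists x; split=> [|y []]; left.
have [e|/lttot [xb|bx]] := pselect (x = b).
- by exists b; split=> [|y [<-|/bmax]] //; [right|left].
- by exists b; split=> [|y [<-|/bmax]] //; right.
- exists x; split=> [|y [->|/bmax [->|yb]]]; [by left|by left|by right|right].
  exact: lttr yb bx.
Qed.

(** * Independent functions *)

Lemma functional1 (S T : Type) (x : S) (a : T) : functional [:: (x, a)].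
Proof. by move=> y b b' [[_ <-]|[]] [[_ <-]|[]]. Qed.

Lemma functional2 (S T : Type) (x y : S) (a b : T) :
  x <> y -> functional [:: (x, a); (y, b)].
Proof.
by move=> xy z c c' [[xz <-]|[[yz <-]|[]]] [[xz' <-]|[[yz' <-]|[]]] //;
   case: xy; rewrite ?xz ?xz' ?yz ?yz'.
Qed.

(* A point is a finite list [F] in [T] with a code for a finite table of values
   indexed by subsets of [F]; the function attached to [A] looks up the trace
   of [A] on [F] (Engelking--Karlowicz). *)
Lemma independent_functions (T : Type) : infinite_set [set: T] ->
  exists p : set T -> T -> nat, forall s : seq (set T * nat), functional s ->
    exists t, forall A n, List.In (A, n) s -> p A t = n.
Proof.
move=> Tinf; have [e eI] := embeds_nat Tinf; have [t0 _] := infinite_setN0 Tinf.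
have [|d dS] := @embeds_surj (seq T * nat) T ([::], 0).
  apply: embeds_trans (embeds_square Tinf).
  by apply: embeds_pair; [exact: embeds_seq|exists e].
pose trace (A : set T) (F : seq T) := [seq `[< A x >] | x <- F].
pose look (mask : seq bool) (tbl : seq (seq bool * nat)) :=
  head 0 [seq q.2 | q <- tbl & q.1 == mask].
exists (fun A t => look (trace A (d t).1) (odflt [::] (unpickle (d t).2))) => s sf.
(* [F] separates the distinct sets named in [s], so the table indexed by their traces on [F] is
   unambiguous. *)
have [F FP] : exists F, forall A B n m, List.In (A, n) s -> List.In (B, m) s ->
    trace A F = trace B F -> A = B.
  have sep (A B : set T) : exists F, trace A F = trace B F -> A = B.
    have [->|nAB] := pselect (A = B); first by exists [::].
    have /existsNP [x nx] : ~ forall x, A x <-> B x.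
      by move=> h; apply: nAB; apply/seteqP; split=> x /h.
    by exists [:: x] => /= tAB; case: nx; apply: asbool_eq_equiv; case: tAB.
  have catP A B F F' : trace A (F ++ F') = trace B (F ++ F') ->
      trace A F = trace B F /\ trace A F' = trace B F'.
    rewrite /trace !map_cat => /eqP; rewrite eqseq_cat ?size_map //.
    by move=> /andP [/eqP ? /eqP ?].
  have one A (r : seq (set T * nat)) : exists F, forall B m,
      List.In (B, m) r -> trace A F = trace B F -> A = B.
    elim: r => [|[B m] r [F FP]]; first by exists [::].
    have [F' F'P] := sep A B; exists (F' ++ F) => C k /= [[<- _]|rC] /catP [].
      by move=> /F'P ->.
    by move=> _; apply: FP rC.
  have all2 (r : seq (set T * nat)) : exists F, forall A B n m,
      List.In (A, n) r -> List.In (B, m) s -> trace A F = trace B F -> A = B.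
    elim: r => [|[A n] r [F FP]]; first by exists [::].
    have [F' F'P] := one A s; exists (F' ++ F) => A' B n' m /= [[<- _]|rA'] sB /catP [].
      by move=> h _; apply: F'P sB h.
    by move=> _; apply: FP rA' sB.
  exact: all2.
pose tbl := [seq (trace q.1 F, q.2) | q <- s].
have [t dt] := dS (F, pickle tbl).
exists t => A n sA; rewrite dt /look (pickleK tbl) [(_, _).1]/=.
have look_in m : List.In m [seq q.2 | q <- tbl & q.1 == trace A F] -> m = n.
  suff h r : (forall q, List.In q r -> List.In q s) ->
      List.In m [seq q.2 | q <- [seq (trace q.1 F, q.2) | q <- r] & q.1 == trace A F] ->
      m = n by exact: h.
  elim: r => [//|[B k] r IH] rs /=.
  case: eqP => [BA|_] /=; last by apply: IH => q rq; apply: rs; right.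
  move=> [<-|]; last by apply: IH => q rq; apply: rs; right.
  have sB : List.In (B, k) s by apply: rs; left.
  by have BeA := FP _ _ _ _ sB sA BA; rewrite BeA in sB; exact: sf sB sA.
have nin : List.In n [seq q.2 | q <- tbl & q.1 == trace A F].
  rewrite /tbl; elim: (s) sA => [//|[B k] r IH] /= [[-> ->]|/IH] /=.
    by rewrite eqxx; left.
  by case: eqP => //= _; right.
by case: [seq _ | _ <- _ & _] nin look_in => [//|m r] _ /= look_in; apply: look_in; left.
Qed.

(** Each [h k] is a function of [gs] alone, and by the choice of [p] a single value [x] of [gs]
    forces any finite assignment of values to the [h k]. A condition over [G] and the [h k] thus
    follows from one over [G] and [gs]. *)
Lemma independent_split (I T K : Type) (D : set_system I) (G : set (I -> T))
    (gs : I -> T) (e : nat -> T) (iota : K -> set T) :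
  infinite_set [set: T] -> Filter D -> independent D (G `|` [set gs]) ->
  ~ G gs -> range gs = [set: T] -> injective e -> injective iota ->
  exists h : K -> I -> T, [/\ injective h, forall k, ~ G (h k),
    forall k n, range (h k) (e n) & independent D (G `|` range h)].
Proof.
move=> Tinf DF indep nG gsT eI iI.
have [p pP] := independent_functions Tinf.
pose h k t := e (p (iota k) (gs t)).
have gsS x : exists t, gs t = x.
  by have [t _ <-] : range gs x; [rewrite gsT|exists t].
have hv (s : seq (K * nat)) : functional s ->
    exists x, forall k n, List.In (k, n) s -> forall t, gs t = x -> h k t = e n.
  move=> sf; have [|x xP] := pP [seq (iota q.1, q.2) | q <- s].
    move=> A n m /List.in_map_iff [[k n'] [[<- <-] kn]].
    by move=> /List.in_map_iff [[k' m'] [[/iI -> <-] km]]; apply: sf kn km.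
  exists x => k n kn t tx; rewrite /h tx (xP _ n) //.
  by apply/List.in_map_iff; exists (k, n).
have hI : injective h.
  move=> k k' kk'; apply: contrapT => ne.
  have [|x xP] := hv [:: (k, 0); (k', 1)].
    exact: functional2.
  have [t tx] := gsS x.
  have h0 : h k t = e 0 by apply: xP tx; left.
  have h1 : h k' t = e 1 by apply: xP tx; right; left.
  by move: h0; rewrite kk' h1 => /eI.
have hr k n : range (h k) (e n).
  have [|x xP] := hv [:: (k, n)].
    exact: functional1.
  by have [t tx] := gsS x; exists t => //; apply: xP tx; left.
have gr x : range gs x by rewrite gsT.
(* If [h k] were in [G], one could ask for [h k = e 0] together with a value of [gs] that forces
   [h k = e 1]; this condition has an empty cell. *)
have hG k : ~ G (h k).
  move=> Gk; have [|x xP] := hv [:: (k, 1)].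
    exact: functional1.
  apply: (indep [:: (h k, e 0); (gs, x)]).
    split.
      move=> g a /= [[<- <-]|[[<- <-]|[]]].
        by split; [left|exact: hr].
      by split; [right|exact: gr].
    by apply: functional2 => e1; apply: nG; rewrite -e1.
  apply: filterE => t ct; have tx : gs t = x by apply: ct; right; left.
  have h0 : h k t = e 0 by apply: ct; left.
  have h1 : h k t = e 1 by apply: xP tx; left.
  by move: h0; rewrite h1 => /eI.
exists h; split=> // c [cW cf] Dc.
(* The part of [c] about the [h k], with functions and values replaced by their indices. *)
have [s [cs sc]] : exists s : seq (K * nat),
    (forall k n, List.In (h k, e n) c -> List.In (k, n) s) /\
    (forall k n, List.In (k, n) s -> List.In (h k, e n) c).
  elim: c {cW cf Dc} => [|[g a] c [s [cs sc]]]; first by exists [::].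
  have [[k [n [-> ->]]]|nga] := pselect (exists k n, g = h k /\ a = e n).
    exists ((k, n) :: s); split=> k' n' /=; last by move=> [[-> ->]|/sc]; [left|right].
    by move=> [[/hI -> /eI ->]|/cs]; [left|right].
  exists s; split=> k n /=; last by move=> /sc; right.
  by move=> [[gk an]|/cs //]; case: nga; exists k, n.
have [|x xP] := hv s.
  by move=> k n m /sc kn /sc km; apply: eI; apply: cf kn km.
pose cG := [seq q <- c | `[< G q.1 >]].
have cGP g a : List.In (g, a) cG <-> List.In (g, a) c /\ G g.
  exact: (In_filter (fun q => G q.1) c (g, a)).
apply: (indep (cG ++ [:: (gs, x)])).
  apply: cond_cat.
  - split; first by move=> g a /cGP [/cW [_ ?] Gg]; split=> //; left.
    by move=> g a b /cGP [ga _] /cGP [gb _]; apply: cf ga gb.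
  - split; first by move=> g a /= [[<- <-]|[]]; split; [right|exact: gr].
    exact: functional1.
  - by move=> g a b /cGP [_ Gg] /= [[e1 _]|//]; case: nG; rewrite e1.
apply: filterS Dc => t nct ct; apply: nct => g a ga.
have [[Gg|[k _ kg]] [t' _ ta]] := cW _ _ ga.
  by apply: ct; apply/List.in_app_iff; left; apply/cGP.
subst g; rewrite -ta.
have kn : List.In (k, p (iota k) (gs t')) s by apply: cs; rewrite -/(h k t') ta.
by apply: (xP _ _ kn); apply: ct; apply/List.in_app_iff; right; left.
Qed.

(** * The filter *)

Lemma In_map (X Y : Type) (f : X -> Y) (s : seq X) y :
  List.In y (map f s) <-> exists x, f x = y /\ List.In x s.
Proof. exact: List.in_map_iff. Qed.

Section Indiscernible.

Variables (I T J : Type) (D : set_system I) (G : set (I -> T)).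
Variables (h : J * bool -> I -> T) (e : nat -> T) (lt : J -> J -> Prop).
Hypotheses (hI : injective h) (eI : injective e) (hG : forall k, ~ G (h k)).
Hypothesis hr : forall k n, range (h k) (e n).
Hypotheses (lt_wf : well_founded lt)
  (lt_trans : forall x y z, lt x y -> lt y z -> lt x z)
  (lt_total : forall x y, x <> y -> lt x y \/ lt y x)
  (lt_nomax : forall x, exists y, lt x y) (J_inh : inhabited J).
Hypotheses (DF : Filter D) (D_indep : independent D (G `|` range h)).

Definition below (b : J) : set (I -> T) :=
  G `|` [set g | exists a i, lt a b /\ g = h (a, i)].

(** When [X n] is the set where a given function into a graph is adjacent to the [n]-th chosen
    vertex, this is where that function fails to separate two distinct vertices attached to [b]. *)
Definition twins (b : J) (X : nat -> set I) : set I :=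
  [set t | exists m n, [/\ h (b, true) t = e m, h (b, false) t = e n, m <> n &
                           X m t <-> X n t]].

Definition decided_below (q : J * (nat -> set I)) : Prop :=
  forall n, densely_decides D (below q.1) (q.2 n).

(** The filter generated by [D] and the sets [twins b X] with [X] decided below [b]. *)
Definition twin_filter : set_system I :=
  [set A | exists s, (forall q, List.In q s -> decided_below q) /\
     D [set t | (forall q, List.In q s -> twins q.1 q.2 t) -> A t]].

Lemma lt_irrefl b : ~ lt b b.
Proof. by elim/(well_founded_ind lt_wf): b => b IH bb; exact: (IH b). Qed.

Lemma below_subset b c : lt b c -> below b `<=` below c.
Proof.
move=> bc g [?|[a [i [ab ->]]]]; first by left.
by right; exists a, i; split=> //; exact: lt_trans bc.
Qed.

Lemma below_sub_all b : below b `<=` G `|` range h.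
Proof. by move=> g [?|[a [i [_ ->]]]]; [left|right; exists (a, i)]. Qed.

Lemma sub_below b : G `<=` below b.
Proof. by move=> g ?; left. Qed.

(* The values [h (b, true) = e i] and [h (b, false) = e j] are still free over
   conditions below [b]; choose [i] and [j] on which [c] makes the same
   decisions. *)
Lemma twins_step b s c : (forall X, List.In X s -> decided_below (b, X)) ->
  cond (below b) c ->
  exists c', [/\ forall a, lt b a -> cond (below a) c', List.incl c c' &
    D [set t | cell c' t -> forall X, List.In X s -> twins b X t]].
Proof.
move=> sb cW.
(* One condition decides [X n] for every [X] in [s] and every [n] up to [2 ^ size s], the range that
   the pigeonhole needs. *)
have [|c1 [c1W cc1 c1s]] := @densely_decides_seq _ _ D (below b)
    (List.flat_map (fun X => map X (iota 0 (2 ^ size s).+1)) s) DF _ c cW.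
  move=> Y /List.in_flat_map [X [sX]].
  by move=> /In_map [n [<- _]]; exact: (sb _ sX n).
have c1dec X n : List.In X s -> n <= 2 ^ size s -> decides D c1 (X n).
  move=> sX nle; apply: c1s; apply/List.in_flat_map; exists X; split=> //.
  apply/In_map; exists n; split=> //.
  have nlt : n < size (iota 0 (2 ^ size s).+1) by rewrite size_iota.
  by have := nth_In 0 nlt; rewrite nth_iota.
have [i [j [ile jle ij ijs]]] := seq_pigeonhole s
  (fun n X => D [set t | cell c1 t -> X n t]).
pose v := [:: (h (b, true), e i); (h (b, false), e j)].
have bneq : h (b, true) <> h (b, false) by move=> /hI.
exists (c1 ++ v); split.
- move=> a ba; apply: cond_cat; first by apply: condS c1W; exact: below_subset.
    split; last exact: functional2.
    move=> g x [[<- <-]|[[<- <-]|[]]]; split; try exact: hr.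
      by right; exists b, true.
    by right; exists b, false.
  (* The functions [h (b, true)] and [h (b, false)] are not below [b], so [c1] does not mention
     them. *)
  move=> g x y gx gy; exfalso; have [k gk] : exists k, g = h (b, k).
    by case: gy => [[<- _]|[[<- _]|[]]]; [exists true|exists false].
  have [[Gg|[a' [k' [a'b gk']]]] _] := c1W.1 _ _ gx.
    by apply: (hG (k := (b, k))); rewrite -gk.
  by move: gk'; rewrite gk => /hI [e1 _]; apply: (lt_irrefl (b := b)); rewrite {1}e1.
- exact: List.incl_tran cc1 (List.incl_appl _ (List.incl_refl _)).
have c1v : List.incl c1 (c1 ++ v) by exact: List.incl_appl (List.incl_refl _).
have agree s' : (forall X, List.In X s' -> List.In X s) ->
    D [set t | cell c1 t -> forall X, List.In X s' -> (X i t <-> X j t)].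
  elim: s' => [|X s' IH] ss'.
    by apply: filterE => t _ X [].
  have := IH (fun Y sY => ss' Y (or_intror sY)); set P := [set t | _] => DP.
  have sX : List.In X s by apply: ss'; left.
  have [pi|ni] := c1dec X i sX ile.
    have pj := (ijs X sX).1 pi; apply: filterS (filterI DP (filterI pi pj)).
    by move=> t [Pt [it jt]] ct Y [<-|sY]; [split=> _; [exact: jt|exact: it]|exact: Pt].
  have [pj|nj] := c1dec X j sX jle.
    have pi := (ijs X sX).2 pj; apply: filterS (filterI DP (filterI pi pj)).
    by move=> t [Pt [it jt]] ct Y [<-|sY]; [split=> _; [exact: jt|exact: it]|exact: Pt].
  apply: filterS (filterI DP (filterI ni nj)).
  by move=> t [Pt [it jt]] ct Y [<-|sY]; [split=> [/(it ct)|/(jt ct)]|exact: Pt].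
apply: filterS (agree s (fun=> id)) => t {}agree ct X sX; exists i, j; split=> //.
- by apply: ct; apply/List.in_app_iff; right; left.
- by apply: ct; apply/List.in_app_iff; right; right; left.
- by apply: agree => //; exact: cell_incl ct.
Qed.

(** Let [a] be the largest index in [s]. The pairs with smaller index are handled by induction, with
    a condition below [a]; then [twins_step] handles all pairs with index [a] at once. *)
Lemma twins_below b s :
  (forall q, List.In q s -> decided_below q /\ lt q.1 b) ->
  forall c, cond G c -> exists c', [/\ cond (below b) c', List.incl c c' &
    D [set t | cell c' t -> forall q, List.In q s -> twins q.1 q.2 t]].
Proof.
elim/(well_founded_ind lt_wf): b s => b IH s sb c cG.
have [->|s0] := pselect (s = [::]).
  exists c; split; [exact: condS (sub_below b) cG|exact: List.incl_refl|].
  by apply: filterE => t _ q [].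
have [|a [/List.in_map_iff [q0 [q0a /sb [_ ab]]] amax]] :=
    seq_max (s := map fst s) lt_trans lt_total; first by case: (s) s0.
rewrite q0a in ab.
have [|c1 [c1W cc1 c1s]] := IH a ab [seq q <- s | `[< lt q.1 a >]] _ c cG.
  move=> q /(In_filter (fun q => lt q.1 a)) [/sb [? _] ?]. by split.
have [|c2 [c2W c12 c2s]] := @twins_step a
    (map snd [seq q <- s | `[< q.1 = a >]]) c1 _ c1W.
  move=> X /List.in_map_iff [[a' Y] [/= <-]].
  by move=> /(In_filter (fun q => q.1 = a)) [/sb [+ _] /= e1]; rewrite e1.
exists c2; split; [exact: c2W|exact: List.incl_tran c12|].
apply: filterS (filterI c1s c2s) => t [t1 t2] ct q sq.
have [qa|qa] := amax q.1 (List.in_map fst _ _ sq).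
  rewrite qa; apply: t2 => //; apply: List.in_map.
  exact/(In_filter (fun q => q.1 = a)).
apply: t1; first exact: cell_incl ct.
exact/(In_filter (fun q => lt q.1 a)).
Qed.

Lemma sub_twin_filter : D `<=` twin_filter.
Proof. by move=> A DA; exists [::]; split=> //; apply: filterS DA => t At _. Qed.

Lemma twins_twin_filter b X : decided_below (b, X) -> twin_filter (twins b X).
Proof.
move=> bX; exists [:: (b, X)]; split; first by move=> q [<-|[]].
by apply: filterE => t /(_ (b, X)); apply; left.
Qed.

Lemma decided_below_apply b k n : below b (h k) ->
  densely_decides D (below b) [set t | h k t = e n].
Proof.
move=> bk c cW.
have [[x kx]|nk] := pselect (exists x, List.In (h k, x) c).
  exists c; split; [by []|exact: List.incl_refl|].
  have [<-|ne] := pselect (x = e n); [left|right]; apply: filterE => t /(_ _ _ kx) //.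
  by move=> /= -> /ne.
exists (c ++ [:: (h k, e 0)]); split.
- apply: cond_cat => //.
    split; last exact: functional1.
    by move=> g a [[<- <-]|[]]; split=> //; exact: hr.
  by move=> g a b' ga [[gk _]|[]]; case: nk; exists a; rewrite gk.
- exact: List.incl_appl (List.incl_refl _).
have ct t : cell (c ++ [:: (h k, e 0)]) t -> h k t = e 0.
  by apply; apply/List.in_app_iff; right; left.
have [->|ne] := pselect (n = 0); [left|right]; apply: filterE => t /ct //= ->.
by move=> /eI /esym /ne.
Qed.

Lemma twin_filter_filter : Filter twin_filter.
Proof.
split; first by apply: sub_twin_filter; exact: filterT.
  move=> A B [s [sd Ds]] [s' [s'd Ds']]; exists (s ++ s'); split.
    by move=> q /List.in_app_iff [/sd|/s'd].
  apply: filterS (filterI Ds Ds') => t [tA tB] tq; split.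
    by apply: tA => q sq; apply: tq; apply/List.in_app_iff; left.
  by apply: tB => q sq; apply: tq; apply/List.in_app_iff; right.
move=> A B AB [s [sd Ds]]; exists s; split=> //.
by apply: filterS Ds => t tA /tA /AB.
Qed.

(** For a constant [X], [twins] only asks for distinct values in the range of [e]. *)
Lemma twin_filter_value k : twin_filter [set t | range e (h k t)].
Proof.
have FF := twin_filter_filter; case: k => b i.
have : twin_filter (twins b (fun=> setT)).
  apply: twins_twin_filter => n c cW; exists c.
  by split; [|exact: List.incl_refl|left; apply: filterE].
apply: filterS => t [m [n [bm bn _ _]]].
by case: i; [exists m|exists n].
Qed.

(** For [lt a b], let [X n] be the set where [h (a, i)] equals [e n]. Where [h (a, i)] agrees with
    one function at [b], the twin condition makes it agree with the other too, although those two
    differ. Equal indices are separated by [m <> n]. *)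
Lemma twin_filter_neq k k' : k <> k' -> twin_filter [set t | h k t <> h k' t].
Proof.
have FF := twin_filter_filter.
have apart a i b j : lt a b -> twin_filter [set t | h (a, i) t <> h (b, j) t].
  move=> ab.
  have : twin_filter (twins b (fun n => [set t | h (a, i) t = e n])).
    apply: twins_twin_filter => n; apply: decided_below_apply.
    by right; exists a, i.
  apply: filterS => t [m [n [bm bn mn X]]] aibj; apply: mn; apply: eI.
  move: X; rewrite /= aibj; case: j {aibj}; rewrite ?bm ?bn; first by case=> ->.
  by case=> _ ->.
case: k k' => [a i] [b j] ne.
have [ab|/lt_total [/apart //|/apart ba]] := pselect (a = b); last first.
  by apply: filterS (ba j i) => t; exact: nesym.
subst b; have ij : i <> j by move=> ij; apply: ne; rewrite ij.
have : twin_filter (twins a (fun=> setT)).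
  apply: twins_twin_filter => n c cW; exists c.
  by split; [|exact: List.incl_refl|left; apply: filterE].
apply: filterS => t [m [n [bm bn mn _]]].
by case: i j ij {ne} => -[] //= _; rewrite bm bn => /eI //; exact: nesym.
Qed.

(** The finitely many indices used have a strict bound [b]. Over it [c] extends to a condition whose
    cell lies, modulo [D], in all the twin sets used, so [D] would contain the complement of that
    cell. *)
Lemma independent_twin_filter : independent twin_filter G.
Proof.
move=> c cG [s [sd Ds]].
have [b sb] : exists b, forall q, List.In q s -> lt q.1 b.
  have [->|s0] := pselect (s = [::]); first by case: J_inh => b; exists b.
  have [|a [_ amax]] := seq_max (s := map fst s) lt_trans lt_total.
    by case: (s) s0.
  have [b ab] := lt_nomax a; exists b => q sq.
  have [->//|qa] := amax q.1 (List.in_map fst _ _ sq); exact: lt_trans ab.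
have [|c' [c'W cc' c's]] := @twins_below b s _ c cG.
  by move=> q sq; split; [exact: sd|exact: sb].
apply: (D_indep (condS (@below_sub_all b) c'W)).
apply: filterS (filterI Ds c's) => t [h1 h2] ct.
by apply: (h1 (h2 ct)); exact: cell_incl ct.
Qed.

Lemma twin_filter_proper : ProperFilter twin_filter.
Proof.
split; last exact: twin_filter_filter.
have c0 : cond G [::] by split.
move=> [s [sd Ds]]; apply: (independent_twin_filter c0); exists s; split=> //.
by apply: filterS Ds => t h1 h2; case: (h1 h2).
Qed.

End Indiscernible.

(** * Models of the theory of the random graph *)

(** The extension axioms of the random graph, with lists for finite sets. *)
Definition extension_property (M : structure) : Prop :=
  forall s t : seq M, (forall x, List.In x s -> ~ List.In x t) ->
  exists z, (forall x, List.In x s -> edge z x) /\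
            (forall x, List.In x t -> ~ edge z x).

(** A type with [n] elements: the variables in scope under [n] quantifiers of a sentence. *)
Definition vars (n : nat) : Type := iter n option void.

Fixpoint universal_closure (n : nat) : formula (vars n) -> sentence :=
  match n with
  | 0 => id
  | n'.+1 => fun phi => @universal_closure n' (fAll phi)
  end.

Lemma holds_universal_closure (M : structure) n (phi : formula (vars n)) :
  holds M (universal_closure phi) <-> forall v : vars n -> M, sat v phi.
Proof.
elim: n phi => [|n IH] phi /=.
  rewrite /holds; split=> [h v|]; last exact.
  by rewrite (_ : v = of_void M) //; apply/funext => -[].
rewrite IH; split=> [h v|h v x]; last exact: h.
rewrite (_ : v = scons (v None) (v \o some)); first exact: h.
by apply/funext => -[].
Qed.

Fixpoint all_vars (n : nat) : seq (vars n) :=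
  match n with
  | 0 => [::]
  | n'.+1 => None :: map some (all_vars n')
  end.

Lemma In_all_vars n (x : vars n) : List.In x (all_vars n).
Proof.
elim: n x => [|n IH] [] //= => [x|]; last by left.
by right; apply/List.in_map_iff; exists x.
Qed.

Definition imps (V : Type) (s : seq (formula V)) (phi : formula V) :=
  foldr (@fImp V) phi s.

Lemma sat_imps (M : structure) (V : Type) (v : V -> M) s phi :
  sat v (imps s phi) <->
  ((forall psi, List.In psi s -> sat v psi) -> sat v phi).
Proof.
elim: s => [|psi s IH] /=; first by split=> [//|]; apply.
split=> [h sP|h hpsi].
  by apply: IH.1 => [|psi' ?]; [apply: h; apply: sP; left|apply: sP; right].
by apply: IH.2 => sP; apply: h => psi' [<-//|/sP].
Qed.

Definition fNot (V : Type) (phi : formula V) : formula V := fImp phi (fFalse V).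

(** [P] marks the variables to be joined to the new vertex. The premises keep marked and unmarked
    variables distinct, padded by a true formula, and the existential is written as a negated
    universal. *)
Definition extension_formula (V : Type) (s : seq V) (P : V -> bool) :
    formula V :=
  imps (List.flat_map (fun x => [seq (if P x && ~~ P y then fNot (fEq x y)
                                      else fNot (fFalse V)) | y <- s]) s)
    (fNot (fAll (imps [seq (if P x then fR None (Some x)
                            else fNot (fR None (Some x))) | x <- s]
                      (fFalse (option V))))).

Lemma sat_extension_formula (M : structure) (V : Type) (v : V -> M) s P :
  (forall x, List.In x s) ->
  sat v (extension_formula s P) <->
  ((forall x y, P x -> ~~ P y -> v x <> v y) ->
   exists z, forall x, if P x then edge z (v x) else ~ edge z (v x)).
Proof.
move=> sP; rewrite /extension_formula sat_imps.
set A := (A in A -> _); set B := (B in _ <-> (B -> _)).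
have AB : A <-> B.
  split=> [h x y Px Py|h psi /List.in_flat_map [x [_ /List.in_map_iff [y [<- _]]]]].
    apply: (h (fNot (fEq x y))); apply/List.in_flat_map; exists x; split=> //.
    by apply/List.in_map_iff; exists y; rewrite Px Py.
  by case: ifP => [/andP [Px Py]|_] /=; [exact: h|].
suff h : sat v (fNot (fAll (imps [seq (if P x then fR None (Some x)
      else fNot (fR None (Some x))) | x <- s] (fFalse (option V))))) <->
    exists z, forall x, if P x then edge z (v x) else ~ edge z (v x).
  by split=> [hA /AB /hA /h|hB /AB /hB /h].
rewrite /=; split=> [h|[z zP] /(_ z) /sat_imps]; last first.
  apply=> psi /List.in_map_iff [x [<- _]].
  by have := zP x; case: ifP.
apply: contrapT => nz; apply: h => z; apply/sat_imps => h; apply: nz; exists z => x.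
have := h _ (List.in_map _ _ _ (sP x)) => /=.
by case: ifP.
Qed.

(** The binary digits of [z] below [N] mark the members of [s]. The leading digit at [N] makes [z]
    exceed every given vertex [x], so adjacency is read from digit [x] of [z] alone. *)
Lemma rado_extension : extension_property rado.
Proof.
move=> s t st /=; pose N := (\max_(x <- s ++ t) x).+1.
have ltN x : List.In x (s ++ t) -> x < N.
  rewrite /N; elim: (s ++ t) => //= y r IH [->|/IH]; rewrite big_cons ltnS.
    exact: leq_maxl.
  by rewrite ltnS => h; apply: leq_trans h (leq_maxr _ _).
pose b x := `[< List.In x s >] : bool.
pose z := 2 ^ N + \sum_(i < N) b i * 2 ^ i.
have ltz x : x < N -> x < z.
  move=> xN; apply: leq_trans (leq_addr _ _); apply: leq_trans xN _.
  exact/ltnW/ltn_expl.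
have digit (M x : nat) (c : nat -> bool) : x < M ->
    odd ((\sum_(i < M) c i * 2 ^ i) %/ 2 ^ x) = c x.
  elim: x M c => [|x IH] [//|M] c xM; rewrite big_ord_recl /= expn0 muln1.
    rewrite divn1 oddD oddb (_ : odd (\sum_(i < M) _) = false) ?addbF //.
    rewrite (eq_bigr (fun i : 'I_M => 2 * (c i.+1 * 2 ^ i))).
      by rewrite -big_distrr /= oddM.
    by move=> i _; rewrite /bump /= expnS mulnCA.
  rewrite (eq_bigr (fun i : 'I_M => 2 * (c i.+1 * 2 ^ i))); last first.
    by move=> i _; rewrite /bump /= expnS mulnCA.
  rewrite -big_distrr /= expnS divnMA addnC [2 * _]mulnC divnMDl //.
  rewrite (divn_small (m := c 0)).
    by rewrite addn0 (IH M (fun i => c i.+1)).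
  by case: (c 0).
have zx x : x < N -> odd (z %/ 2 ^ x) = b x.
  (* Since [x < N], the leading term contributes an even number after division by [2 ^ x]. *)
  move=> xN; have -> : z = 2 ^ (N - x) * 2 ^ x + \sum_(i < N) b i * 2 ^ i.
    by rewrite -expnD subnK // ltnW.
  rewrite divnMDl ?expn_gt0 // oddD digit // oddX subn_eq0 leqNgt xN.
  by rewrite addFb.
have xz x : x < N -> odd (x %/ 2 ^ z) = false.
  move=> xN; rewrite divn_small //; apply: leq_trans (ltz _ xN) _.
  exact/ltnW/ltn_expl.
exists z; split=> x xs.
  have xN : x < N by apply/ltN/List.in_app_iff; left.
  by rewrite zx //; apply/orP; left; apply/asboolP.
have xN : x < N by apply/ltN/List.in_app_iff; right.
by rewrite zx // xz // orbF => /asboolP /st.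
Qed.

Lemma rado_irreflexive (x : nat) : ~ @edge rado x x.
Proof. by rewrite /= orbb divn_small // ltn_expl. Qed.

Fixpoint assign (X : Type) (s : seq X) : vars (size s) -> X :=
  match s with
  | [::] => @of_void X
  | x :: s' => scons x (assign (s := s'))
  end.

Lemma assign_range (X : Type) (s : seq X) x :
  (exists i, assign (s := s) i = x) <-> List.In x s.
Proof.
elim: s => [|y s IH] /=; first by split=> [[]|].
split=> [[[i|]] /= e|[->|/IH [i <-]]]; [|by left|by exists None|by exists (Some i)].
by right; apply/IH; exists i.
Qed.

(** For fixed lengths of the lists the extension axiom is one sentence. It holds in [rado], so it
    belongs to [T_rg] and can be instantiated in [M]. *)
Lemma models_extension (M : structure) :
  models M T_rg -> extension_property M.
Proof.
move=> MT s t st.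
(* The variables are the positions in [r]; the tag tells whether an entry comes from [s]. *)
pose r := [seq (x, true) | x <- s] ++ [seq (x, false) | x <- t].
pose v := assign (s := r).
pose phi := extension_formula (all_vars (size r)) (fun i => (v i).2).
have /holds_universal_closure /(_ (fst \o v)) : holds M (universal_closure phi).
  apply: MT; apply/holds_universal_closure => w; apply/sat_extension_formula.
    exact: In_all_vars.
  move=> wP; set P := fun i => (v i).2.
  have [|z [zs zt]] := @rado_extension
      (map w [seq i <- all_vars (size r) | `[< P i = true >]])
      (map w [seq i <- all_vars (size r) | `[< P i = false >]]).
    move=> x /List.in_map_iff [i [<- /(In_filter (fun i => P i = true)) [_ Pi]]].
    move=> /List.in_map_iff [j [e1 /(In_filter (fun i => P i = false)) [_ Pj]]].
    by apply: (wP i j) => //; rewrite -/(P j) Pj.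
  exists z => i; case: ifP => Pi; [apply: zs|apply: zt]; apply: List.in_map.
    by apply/(In_filter (fun i => P i = true)); split=> //; exact: In_all_vars.
  by apply/(In_filter (fun i => P i = false)); split=> //; exact: In_all_vars.
have vr i : List.In (v i) r by apply/assign_range; exists i.
move=> /sat_extension_formula [|i j Pi Pj /= e|z zP].
- exact: In_all_vars.
- have /List.in_app_iff [/List.in_map_iff [x [xi xs]]|
    /List.in_map_iff [x [xi xs]]] := vr i;
  have /List.in_app_iff [/List.in_map_iff [y [yj yt]]|
    /List.in_map_iff [y [yj yt]]] := vr j;
  move: Pi Pj e; rewrite -xi -yj //= => _ _ e.
  by apply: (st x) => //; rewrite e.
exists z; split=> x xs.
  have [|i ix] := (assign_range r (x, true)).2.
    by apply/List.in_app_iff; left; apply/List.in_map_iff; exists x.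
  by have := zP i; rewrite /= /v ix.
have [|i ix] := (assign_range r (x, false)).2.
  by apply/List.in_app_iff; right; apply/List.in_map_iff; exists x.
by have := zP i; rewrite /= /v ix.
Qed.

Lemma models_irreflexive (M : structure) (x : M) :
  models M T_rg -> ~ edge x x.
Proof.
move=> MT; have : holds M (fAll (fNot (fR None None))); last exact.
by apply: MT => y; exact: rado_irreflexive.
Qed.

(** In a finite model some vertex would be adjacent to all vertices, itself included. *)
Lemma models_infinite (M : structure) : models M T_rg -> embeds nat M.
Proof.
move=> MT; apply/embeds_nat => /finite_set_list [s sP].
have [|z [zs _]] := models_extension MT (s := s) (t := [::]) => [x _ []|].
exact/(models_irreflexive MT)/zs/sP.
Qed.

(** * Ultrapowers *)

Section Ultrapower.

Variables (M : structure) (I : Type) (D : set_system I).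
Hypothesis DP : ProperFilter D.

Definition upclass (f : I -> M) : ultrapower M D :=
  exist _ [set g | eq_mod D f g] (ex_intro _ f erefl).

Lemma upclass_surj (x : ultrapower M D) : exists f, x = upclass f.
Proof. by case: x => C [f Cf]; exists f; apply: eq_exist. Qed.

Lemma edge_upclass f g :
  edge (upclass f) (upclass g) <-> D [set t | edge (f t) (g t)].
Proof.
split=> [[f' [g' /= [ff' gg' e]]]|e].
  by apply: filterS (filterI (filterI ff' gg') e) => t [[/= -> ->]].
by exists f, g; split=> //; apply: filterE.
Qed.

Lemma filter_seq (X : Type) (P : X -> set I) s :
  (forall x, List.In x s -> D (P x)) -> D [set t | forall x, List.In x s -> P x t].
Proof.
elim: s => [|x s IH] sP; first by apply: filterE => t x [].
have := IH (fun y sy => sP y (or_intror sy)).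
apply: filterS2 (sP x (or_introl erefl)) => t xt st y [<- //|]; exact: st.
Qed.

Lemma seq_image (X Y : Type) (P : X -> Y -> Prop) s :
  (forall x, List.In x s -> exists y, P x y) ->
  exists r, forall x, List.In x s -> exists2 y, List.In y r & P x y.
Proof.
elim: s => [|x s IH] sP; first by exists [::].
have [r rP] := IH (fun y sy => sP y (or_intror sy)).
have [y xy] := sP x (or_introl erefl).
exists (y :: r) => z [<-|/rP [w rw zw]]; first by exists y => //; left.
by exists w => //; right.
Qed.

(** The omitted type asks for adjacency to each [a (j, true)] and non-adjacency to each
    [a (j, false)]. Finite parts are realized coordinatewise, and the [j] attached to a function [b]
    shows that its class does not realize the whole. *)
Lemma not_saturated (J K K' : Type) (a : J * bool -> I -> M) :
  extension_property M -> embeds (J * bool) K -> card_lt [set: K] [set: K'] ->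
  (forall k k', k <> k' -> D [set t | a k t <> a k' t]) ->
  (forall b : I -> M, exists j,
     D [set t | edge (b t) (a (j, true) t) <-> edge (b t) (a (j, false) t)]) ->
  ~ saturated K' (ultrapower M D).
Proof.
move=> Mext /embedsP JK [KK' /negP nKK'] aneq ab sat.
pose A : set (ultrapower M D) := range (upclass \o a).
have AK : A #<= [set: K] by apply: card_le_trans JK; exact: card_image_le.
have AK' : card_lt A [set: K'].
  split; first exact: card_le_trans KK'.
  apply/negP; rewrite card_eq_le => /andP [_ K'A]; apply: nKK'.
  by rewrite card_eq_le KK' (card_le_trans K'A).
pose lit (k : J * bool) (x : A) : formula1 A :=
  if k.2 then fR None (Some x) else fNot (fR None (Some x)).
pose p : set (formula1 A) := [set phi | exists k x,
  val x = upclass (a k) /\ phi = lit k x].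
have litP f k x : val x = upclass (a k) -> satisfies (upclass f) (lit k x) <->
    if k.2 then D [set t | edge (f t) (a k t)]
    else ~ D [set t | edge (f t) (a k t)].
  move=> xk; rewrite /lit /satisfies; case: k.2 => /=; rewrite xk.
    exact: edge_upclass.
  by split=> h /edge_upclass.
have ptype : is_type p.
  move=> q /finite_set_list [s sP] qp.
  have [|r rP] := @seq_image _ _ (fun phi k => exists x,
      val x = upclass (a k) /\ phi = lit k x) s; first by move=> phi /sP /qp.
  pose side (i : bool) t := [seq a k t | k <- r & k.2 == i].
  have sideP i t x : List.In x (side i t) <->
      exists k, [/\ List.In k r, k.2 = i & a k t = x].
    rewrite /side; elim: (r) => [|k r' IH] /=; first by split=> [|[? []]].
    case: eqP => ki /=; rewrite IH; split.
    - by move=> [<-|[k' [? ? ?]]]; [exists k|exists k']; split=> //; [left|right].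
    - by move=> [k' [[->|?] ? ?]]; [left|right; exists k'].
    - by move=> [k' [? ? ?]]; exists k'; split=> //; right.
    - by move=> [k' [[e1|?] ? ?]]; [case: ki; rewrite e1|exists k'].
  (* The realization is chosen at each [t] separately; it is arbitrary where the two sides overlap,
     which by [good_t] is negligible. *)
  have /choice [b bP] : forall t, exists z,
      (forall x, List.In x (side true t) -> ~ List.In x (side false t)) ->
      (forall x, List.In x (side true t) -> edge z x) /\
      (forall x, List.In x (side false t) -> ~ edge z x).
    move=> t; have [/Mext [z zP]|nC] := pselect (forall x,
      List.In x (side true t) -> ~ List.In x (side false t)); first by exists z.
    by have [|z _] := Mext [::] [::]; [by []|exists z => /nC].
  have good_t : D [set t | forall x,
      List.In x (side true t) -> ~ List.In x (side false t)].
    have : D [set t | forall k, List.In k r -> forall k', List.In k' r ->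
        k <> k' -> a k t <> a k' t].
      apply: (@filter_seq _ (fun k => [set t | forall k', List.In k' r ->
        k <> k' -> a k t <> a k' t])) => k _.
      apply: (@filter_seq _ (fun k' => [set t | k <> k' -> a k t <> a k' t])) => k' _.
      have [->|/aneq] := pselect (k = k'); first by apply: filterE => t /(_ erefl).
      by apply: filterS => t ne _.
    apply: filterS => t ne x /sideP [k [rk k1 kx]] /sideP [k' [rk' k'0 k'x]].
    apply: (ne k rk k' rk'); last by rewrite kx.
    by move=> kk'; move: k1; rewrite kk' k'0.
  exists (upclass b) => phi qphi.
  have [k rk [x [xk ->]]] := rP phi ((sP phi).1 qphi).
  apply/(litP b k x xk); case ki: k.2.
    apply: filterS good_t => t /bP [h _]; apply: h.
    by apply/sideP; exists k.
  move=> /(filterI good_t) Dk; apply: (@filter_not_empty _ D DP).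
  apply: filterS Dk => t [/bP [_ h]]; apply: h.
  by apply/sideP; exists k.
have [x xp] := sat A AK' p ptype; have [b xb] := upclass_surj x; subst x.
have [j Dj] := ab b.
have inA k : upclass (a k) \in A by apply/mem_set; exists k.
have lits k : if k.2 then D [set t | edge (b t) (a k t)]
    else ~ D [set t | edge (b t) (a k t)].
  apply/(litP b k (SigSub (inA k)) erefl); apply: xp.
  by exists k, (SigSub (inA k)).
apply: (lits (j, false)); apply: filterS (filterI Dj (lits (j, true))).
by move=> t [[h _] /h].
Qed.

End Ultrapower.

Theorem theorem6p1 (L Mu Mu1 I : Type) (D0 : set_system I)
    (G : set (I -> Mu)) (gs : I -> Mu)
    (L_inf : infinite_set [set: L]) (Mu_inf : infinite_set [set: Mu])
    (I_card : [set: I] #= [set: L])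
    (D0_reg : regular_filter L D0)
    (gs_notin : ~ G gs)
    (D0_good : good L D0 (G `|` [set gs]))
    (Mu1_succ : is_succ_card Mu Mu1)
    (Mu1_lt : card_lt [set: Mu1] [set: L])
    (gs_range : range gs = [set: Mu]) :
  exists D : set_system I,
    [/\ ProperFilter D, D0 `<=` D, good L D G &
        forall (Ds : set_system I) (M : structure),
          UltraFilter Ds -> D `<=` Ds -> models M T_rg ->
          (forall Mu2 : Type, is_succ_card Mu1 Mu2 ->
             ~ saturated Mu2 (ultrapower M Ds)) /\
          (forall L1 : Type, is_succ_card L L1 ->
             ~ saturated L1 (ultrapower M Ds))].
Proof.
have [e eI] := embeds_nat Mu_inf.
(* No [Mu]-indexed family is cofinal in [J]; this bounds the indices on which a single function
   depends. *)
have [J [lt [JMu1 lt_wf lt_trans lt_total [J_inh lt_sup]]]] :=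
  cofinal_order Mu_inf (succ_not_embeds Mu1_succ).
have Mu1_inf : infinite_set [set: Mu1].
  apply/infiniteP/embedsP; apply: embeds_trans (embeds_nat Mu_inf) _.
  by apply/embedsP; case: Mu1_succ => -[].
have JbMu1 : embeds (J * bool) Mu1.
  apply: embeds_trans (embeds_square Mu1_inf); apply: embeds_pair JMu1 _.
  apply: embeds_trans (embeds_nat Mu1_inf).
  by exists nat_of_bool => -[] [].
have [iota iotaI] := embeds_trans JbMu1 (succ_embeds_set Mu1_succ).
have D0P := good_filter D0_good.
have [h [hI hG hr D0h]] := independent_split Mu_inf (filter_filter (F := D0))
  ((independentP _ _).1 (let: conj (And4 _ _ _ x) _ := D0_good in x))
  gs_notin gs_range eI iotaI.
(* Maximality over the split family is what lets conditions on it decide arbitrary subsets of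
   [I]. *)
have [D1 D1_good D01] := pre_good_good
  (pre_goodS D0_good.1 (@subset_refl _ D0) D0P D0h).
have D1P := good_filter D1_good.
have D1h : independent D1 (G `|` range h).
  by apply/independentP; case: D1_good => -[].
have lt_nomax j : exists j', lt j j' by have [b bP] := lt_sup (fun=> j);
  have [x _] := infinite_setN0 Mu_inf; exists b; exact: bP x.
pose D2 := twin_filter D1 G h e lt.
have D12 : D1 `<=` D2 by exact: sub_twin_filter.
have D2P : ProperFilter D2 by exact: twin_filter_proper.
have D2G : independent D2 G by exact: independent_twin_filter.
have [D D_good D2D] := pre_good_good (pre_goodS D1_good.1 D12 D2P D2G).
exists D; split=> //; first exact: good_filter D_good.
  by move=> A /D01 /D12 /D2D.
move=> Ds M DsU DDs MT.
have DsP : ProperFilter Ds by exact: ultra_proper.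
have D2Ds A : D2 A -> Ds A by move=> /D2D /DDs.
have [m mI] := models_infinite MT.
(* [dec] inverts [e]. Its default 0 is harmless, since [D2] keeps the values of each [h k] in the
   range of [e]. *)
have /choice [dec decP] : forall x, exists n, forall n', e n' = x -> n = n'.
  move=> x; have [[n <-]|nx] := pselect (exists n, e n = x).
    by exists n => n' /eI.
  by exists 0 => n' en'; case: nx; exists n'.
pose a k t := m (dec (h k t)).
have aE k t n : h k t = e n -> a k t = m n.
  by move=> kt; rewrite /a (decP _ n).
(* Stated for any [K] with room for the parameters, to serve both [Mu1] and [L]. *)
have unsat K K' : embeds (J * bool) K -> card_lt [set: K] [set: K'] ->
    ~ saturated K' (ultrapower M Ds).
  move=> JK KK'; apply: (not_saturated (a := a) DsP (models_extension MT) JK KK').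
    move=> k k' kk'; apply: D2Ds.
    have D2_filter : Filter D2 by exact: filter_filter.
    have neq : D2 [set t | h k t <> h k' t] by exact: twin_filter_neq.
    have val k0 : D2 [set t | range e (h k0 t)] by exact: twin_filter_value.
    apply: (@filterS _ D2 _ _ _ _ (filterI neq (filterI (val k) (val k')))).
    move=> t [ne [[n _ kn] [n' _ kn']]].
    rewrite /= (aE _ _ n) // (aE _ _ n') // => /mI nn'.
    by apply: ne; rewrite -kn -kn' nn'.
  move=> b; pose X n := [set t | edge (b t) (m n)].
  have [j0] := J_inh; have U0 : (G `|` range h) !=set0.
    by exists (h (j0, true)); right; exists (j0, true).
  have [phi phiP] := small_densely_decides X D1_good U0.
  (* [S x] is the index of [phi x] when that is one of the [h (j, i)], and [j0] otherwise. A strict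
     bound [j] of [S] puts every function of the support below [j]. *)
  have /choice [S SP] : forall x, exists j, forall j' i, phi x = h (j', i) -> j = j'.
    move=> x; have [[j [i xj]]|nx] := pselect (exists j i, phi x = h (j, i)).
      by exists j => j' i'; rewrite xj => /hI [].
    by exists j0 => j' i xj; case: nx; exists j', i.
  have [j jP] := lt_sup S; exists j; apply: D2Ds.
  have D2_filter : Filter D2 by exact: filter_filter.
  have : D2 (twins h e j X).
    apply: twins_twin_filter => n; apply: densely_decidesS (phiP n) => g.
    move=> [[x _ xg] [Gg|[[j' i] _ jg]]]; first by left.
    by right; exists j', i; split=> //; rewrite -(SP x j' i) // xg.
  apply: filterS => t [p [q [jp jq _ Xpq]]].
  by rewrite /= (aE _ _ p) // (aE _ _ q).
split=> [Mu2 [lt2 _]|L1 [ltL1 _]]; first exact: unsat lt2.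
by apply: unsat ltL1; apply: embeds_trans JbMu1 _; apply/embedsP; case: Mu1_lt.
Qed.
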